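(* The full opacity decision problem and the weak opacity decision problem are undecidable for timed automata with a single clock (with $\varepsilon$-transitions allowed).
   Context: A timed automaton (TA) is a tuple $\mathcal{A}=(\Sigma,L,\ell_0,L_{priv},L_f,X,I,E)$ where $\Sigma$ is a finite set of actions, $L$ a finite set of locations, $\ell_0\in L$ the initial location, $L_{priv}\subseteq L$ the set of private locations, $L_f\subseteq L$ the set of final locations, $X$ a finite set of clocks, $I$ assigns to each location an invariant, and $E$ is a finite set of edges $(\ell,g,a,R,\ell')$ with $\ell,\ell'\in L$, $a\in\Sigma\cup\{\varepsilon\}$ (where $\varepsilon$ is an unobservable action; edges labelled $\varepsilon$ are $\varepsilon$-transitions), $R\subseteq X$ the set of clocks to reset, and $g$ a guard. Invariants and guards are conjunctions of constraints $x\bowtie d$ with $x\in X$, $d\in\mathbb{Z}$, ${\bowtie}\in\{<,\le,=,\ge,>\}$. A clock valuation is a map $\mu:X\to\mathbb{R}_{\ge0}$; a configuration is a pair $(\ell,\mu)$ with $\mu\models I(\ell)$; the initial configuration is $(\ell_0,\mathbf{0})$. A delay $d\ge0$ leads from $(\ell,\mu)$ to $(\ell,\mu+d)$ provided $\mu+d'\models I(\ell)$ for all $d'\in[0,d]$; an edge $(\ell,g,a,R,\ell')$ leads from $(\ell,\mu)$ to $(\ell',\mu')$ if $\mu\models g$, $\mu'$ is $\mu$ with the clocks of $R$ set to $0$, and $\mu'\models I(\ell')$. A run is a finite sequence $(\ell_0,\mu_0),(d_0,e_0),(\ell_1,\mu_1),\dots,(\ell_n,\mu_n)$ starting in the initial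 configuration, where each step is a delay $d_i$ followed by taking edge $e_i$, with $\ell_n\in L_f$ and $\ell_i\notin L_f$ for $i<n$. A timed word is a finite sequence of pairs $(a,t)\in\Sigma\times\mathbb{R}_{\ge0}$ with non-decreasing timestamps. The trace of a run is the timed word consisting, in order, of the pairs $(a_i,\sum_{j\le i}d_j)$ for the edges $e_i$ whose action $a_i$ is not $\varepsilon$. A run is private if it visits some location of $L_{priv}$ and public otherwise; $\mathrm{PrivTr}(\mathcal{A})$ and $\mathrm{PubTr}(\mathcal{A})$ denote the sets of traces of private, resp. public, runs. $\mathcal{A}$ is weakly opaque if $\mathrm{PrivTr}(\mathcal{A})\subseteq\mathrm{PubTr}(\mathcal{A})$ and fully opaque if $\mathrm{PrivTr}(\mathcal{A})=\mathrm{PubTr}(\mathcal{A})$. The weak (resp. full) opacity decision problem asks, given a TA, whether it is weakly (resp. fully) opaque. *)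

(* Defs.v *)
From HB Require Import structures.
From mathcomp Require Import all_boot all_order all_algebra.
From mathcomp Require Import all_classical reals.

Set Implicit Arguments.
Unset Strict Implicit.
Unset Printing Implicit Defensive.

Import Order.TTheory GRing.Theory Num.Theory.

Local Open Scope classical_set_scope.
Local Open Scope ring_scope.

Inductive cmp := CLt | CLe | CEq | CGe | CGt.

Definition nat_of_cmp (b : cmp) : nat :=
  match b with CLt => 0 | CLe => 1 | CEq => 2 | CGe => 3 | CGt => 4 end%N.

Definition cmp_of_nat (n : nat) : cmp :=
  match n with 0 => CLt | 1 => CLe | 2 => CEq | 3 => CGe | _ => CGt end%N.

Lemma nat_of_cmpK : cancel nat_of_cmp cmp_of_nat.
Proof. by case. Qed.

HB.instance Definition _ := Countable.copy cmp (can_type nat_of_cmpK).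

(* The triple (x, b, d) is the constraint "x b d"; a list is a conjunction. *)
Definition constraint (X : finType) : Type := seq (X * cmp * int).

Record edge (Sigma L X : finType) := Edge {
  src : L;
  guard : constraint X;
  act : option Sigma;  (* None is the unobservable action epsilon *)
  resets : {set X};
  tgt : L }.

Section EdgeEqType.
Variables Sigma L X : finType.

Definition tuple_of_edge (e : edge Sigma L X) :=
  (src e, guard e : seq (X * cmp * int), act e, resets e, tgt e).

Definition edge_of_tuple t : edge Sigma L X :=
  let: (l, g, a, r, l') := t in Edge l g a r l'.

Lemma tuple_of_edgeK : cancel tuple_of_edge edge_of_tuple.
Proof. by case. Qed.

HB.instance Definition _ :=
  Countable.copy (edge Sigma L X) (can_type tuple_of_edgeK).
End EdgeEqType.

(* The list [edges] stands for a finite set: order and repetitions are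
   irrelevant, as only membership is used in the semantics. *)
Record ta (Sigma L X : finType) := TA {
  init : L;
  priv : {set L};
  final : {set L};
  inv : {ffun L -> constraint X};
  edges : seq (edge Sigma L X) }.

Section Semantics.
Variables (R : realType) (Sigma L X : finType).
Implicit Types (A : ta Sigma L X) (e : edge Sigma L X).

(* Only valuations reachable from 0 by nonnegative delays and resets occur in
   runs, so they are automatically nonnegative. *)
Definition valuation : Type := {ffun X -> R}.

Definition cmp_sem (b : cmp) (u v : R) : bool :=
  match b with
  | CLt => u < v
  | CLe => u <= v
  | CEq => u == v
  | CGe => u >= v
  | CGt => u > v
  end.

Definition sat (mu : valuation) (g : constraint X) : bool :=
  all (fun c : X * cmp * int => cmp_sem c.1.2 (mu c.1.1) c.2%:~R) g.

Definition val0 : valuation := [ffun => 0].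
Definition delay (mu : valuation) (d : R) : valuation := [ffun x => mu x + d].
Definition reset (mu : valuation) (r : {set X}) : valuation :=
  [ffun x => if x \in r then 0 else mu x].

Definition config : Type := (L * valuation)%type.

Definition is_config A (c : config) : bool := sat c.2 (inv A c.1).

Definition delay_step A (c : config) (d : R) (c' : config) : Prop :=
  [/\ 0 <= d,
      forall d', 0 <= d' <= d -> sat (delay c.2 d') (inv A c.1)
    & c' = (c.1, delay c.2 d)].

Definition edge_step A (c : config) e (c' : config) : Prop :=
  [/\ e \in edges A, src e = c.1, sat c.2 (guard e),
      c' = (tgt e, reset c.2 (resets e)) & is_config A c'].

Definition step A (c : config) (d : R) e (c' : config) : Prop :=
  exists2 c1, delay_step A c d c1 & edge_step A c1 e c'.

(* The sequence c_0, (d_0, e_0), c_1, ..., c_n is represented by the list of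
   the (d_i, e_i, c_(i+1)), c_0 being always the initial configuration. *)
Definition path_ta : Type := seq (R * edge Sigma L X * config).

Fixpoint is_path A (c : config) (p : path_ta) : Prop :=
  if p is (d, e, c') :: p' then step A c d e c' /\ is_path A c' p' else True.

Definition locs (p : path_ta) : seq L := [seq s.2.1 | s <- p].

Definition is_run A (p : path_ta) : Prop :=
  [/\ is_config A (init A, val0),
      is_path A (init A, val0) p,
      last (init A) (locs p) \in final A
    & all (fun l => l \notin final A) (belast (init A) (locs p))].

Definition is_private A (p : path_ta) : bool :=
  has (fun l => l \in priv A) (init A :: locs p).

Fixpoint trace_from (t : R) (p : path_ta) : seq (Sigma * R) :=
  if p is (d, e, _) :: p' then
    let tr := trace_from (t + d) p' in
    if act e is Some a then (a, t + d) :: tr else tr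
  else [::].

Definition trace (p : path_ta) : seq (Sigma * R) := trace_from 0 p.

Definition PrivTr A : set (seq (Sigma * R)) :=
  [set w | exists p, [/\ is_run A p, is_private A p & trace p = w]].

Definition PubTr A : set (seq (Sigma * R)) :=
  [set w | exists p, [/\ is_run A p, ~~ is_private A p & trace p = w]].

Definition weakly_opaque A : Prop := PrivTr A `<=` PubTr A.
Definition fully_opaque A : Prop := PrivTr A = PubTr A.

End Semantics.

Local Open Scope nat_scope.

Inductive recfun : nat -> Type :=
| RZero k : recfun k
| RSucc : recfun 1
| RProj k : 'I_k -> recfun k
| RComp k m : recfun m -> ('I_m -> recfun k) -> recfun k
| RPrim k : recfun k -> recfun k.+2 -> recfun k.+1
| RMu k : recfun k.+1 -> recfun k.

(* [computes f v y]: f is defined at v, with value y.  Primitive recursion is on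
   the first argument: h(0, v) = f(v), h(i+1, v) = g(i, h(i, v), v). *)
Fixpoint computes k (f : recfun k) : k.-tuple nat -> nat -> Prop :=
  match f in recfun k return k.-tuple nat -> nat -> Prop with
  | RZero _ => fun _ y => y = 0
  | RSucc => fun v y => y = (thead v).+1
  | RProj _ i => fun v y => y = tnth v i
  | RComp _ m f g => fun v y =>
      exists2 w : m.-tuple nat,
        forall i, computes (g i) v (tnth w i) & computes f w y
  | RPrim k f g => fun v y =>
      exists h : nat -> nat,
        [/\ computes f (behead_tuple v) (h 0),
            forall i, i < thead v ->
              computes g [tuple of i :: h i :: behead_tuple v] (h i.+1)
          & y = h (thead v)]
  | RMu _ f => fun v y =>
      computes f [tuple of y :: v] 0 /\
      forall i, i < y -> exists z, computes f [tuple of i :: v] z.+1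
  end.

Definition code_int (d : int) : nat :=
  match d with Posz n => n.*2 | Negz n => n.*2.+1 end.

Definition code_constraint k (g : constraint 'I_k) : nat :=
  CodeSeq.code
    [seq CodeSeq.code [:: val c.1.1; nat_of_cmp c.1.2; code_int c.2] | c <- g].

Definition code_set k (B : {set 'I_k}) : nat :=
  CodeSeq.code [seq val i | i <- enum B].

Definition code_act n (a : option 'I_n) : nat := if a is Some i then i.+1 else 0.

Definition code_edge n m k (e : edge 'I_n 'I_m 'I_k) : nat :=
  CodeSeq.code [:: val (src e); code_constraint (guard e); code_act (act e);
                   code_set (resets e); val (tgt e)].

Definition code_ta n m k (A : ta 'I_n 'I_m 'I_k) : nat :=
  CodeSeq.code [:: n; m; k; val (init A); code_set (priv A); code_set (final A);
                   CodeSeq.code [seq code_constraint (inv A l) | l <- enum 'I_m];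
                   CodeSeq.code [seq code_edge e | e <- edges A]].

(* An instance is a timed automaton whose finite sets of actions, locations and
   clocks are initial segments of nat; k is the number of clocks.  The decider
   must answer on every code of an instance. *)
Definition ta_decidable (k : nat)
    (P : forall n m, ta 'I_n 'I_m 'I_k -> Prop) : Prop :=
  exists f : recfun 1, forall n m (A : ta 'I_n 'I_m 'I_k),
    (P n m A -> computes f [tuple code_ta A] 1) /\
    (~ P n m A -> computes f [tuple code_ta A] 0).

Lemma computes_inj k (f : recfun k) v y1 y2 :
  computes f v y1 -> computes f v y2 -> y1 = y2.
Proof.
elim: f v y1 y2 => {k} [k|||k m f IHf g IHg|k f IHf g IHg|k f IHf] //=.
- by move=> v y1 y2 -> ->.
- by move=> v y1 y2 -> ->.
- by move=> k i v y1 y2 -> ->.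
- move=> v y1 y2 [w1 Hg1 Hf1] [w2 Hg2 Hf2].
  suff E : w1 = w2 by move: Hf1; rewrite E => /IHf; apply.
  by apply: eq_from_tnth => i; apply: IHg (Hg1 i) (Hg2 i).
- move=> v y1 y2 [h1 [H0 H1 ->]] [h2 [K0 K1 ->]].
  have: thead v <= thead v by [].
  elim: {1 3 4}(thead v) => [_|i IHi ltiv]; first exact: IHf H0 K0.
  have := H1 i ltiv; rewrite (IHi (ltnW ltiv)) => H; exact: IHg H (K1 i ltiv).
- move=> v y1 y2 [H0 H1] [K0 K1]; case: (ltngtP y1 y2) => //.
    by case/K1=> z Hz; have := IHf _ _ _ H0 Hz.
  by case/H1=> z Hz; have := IHf _ _ _ K0 Hz.
Qed.

(* A non-injective numbering would make undecidability vacuous; the following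
   lemmas rule this out, also across different sizes of the finite sets. *)
Lemma code_int_inj : injective code_int.
Proof.
move=> [a|a] [b|b] /= E; have := congr1 odd E; have := congr1 half E;
  by rewrite /= ?odd_double ?uphalf_double ?doubleK //= => ->.
Qed.

Lemma code_constraint_inj k : injective (@code_constraint k).
Proof.
move=> g1 g2 /(can_inj CodeSeq.codeK); apply: inj_map.
move=> [[x b] d] [[x' b'] d'] /(can_inj CodeSeq.codeK) /= [].
by move=> /val_inj -> /(can_inj nat_of_cmpK) -> /code_int_inj ->.
Qed.

Lemma code_set_inj k : injective (@code_set k).
Proof.
move=> B1 B2 /(can_inj CodeSeq.codeK) /(inj_map val_inj) E.
by apply/setP => x; rewrite -mem_enum E mem_enum.
Qed.

Lemma code_act_inj n : injective (@code_act n).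
Proof. by case=> [a|] [b|] //= [/val_inj ->]. Qed.

Lemma code_edge_inj n m k : injective (@code_edge n m k).
Proof.
move=> [s g a r t] [s' g' a' r' t'] /(can_inj CodeSeq.codeK) /= [].
move=> /val_inj -> /code_constraint_inj -> /code_act_inj ->.
by move=> /code_set_inj -> /val_inj ->.
Qed.

Lemma code_ta_inj n m k : injective (@code_ta n m k).
Proof.
move=> [i p f v s] [i' p' f' v' s'] /(can_inj CodeSeq.codeK) [].
move=> /= /val_inj -> /code_set_inj -> /code_set_inj ->.
move=> /(can_inj CodeSeq.codeK) /eq_in_map E.
move=> /(can_inj CodeSeq.codeK) /(inj_map (@code_edge_inj n m k)) ->.
congr TA; apply/ffunP => l; apply: code_constraint_inj; apply: E.
by rewrite mem_enum.
Qed.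

Lemma code_ta_sizes n m k n' m' k'
    (A : ta 'I_n 'I_m 'I_k) (A' : ta 'I_n' 'I_m' 'I_k') :
  code_ta A = code_ta A' -> [/\ n = n', m = m' & k = k'].
Proof. by move/(can_inj CodeSeq.codeK) => []. Qed.

(* Main.v *)
Require Import Defs.
From HB Require Import structures.
From mathcomp Require Import all_boot all_order all_algebra.
From mathcomp Require Import boolp reals.
From mathcomp Require Import zify lra.

(** The public part of the automaton accepts exactly the timed words that fail
    to encode a halting run of a counter machine, while its private part accepts
    every timed word, so that it is opaque, weakly or fully, if and only if the
    machine does not halt.  A run is written with one configuration per time
    unit: at integer distances from the start stand markers naming the
    transitions, and each unit of a register is an event in the open interval
    between two markers, to be copied exactly one time unit later.  An event that
    is not copied is detected with one clock, reset at this event.  An event at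
    time t + 1 that copies nothing is detected by an epsilon-transition that
    resets the clock at the guessed time t, after having checked that time has
    elapsed since the last event.  The input e of the machine occurs only as an
    integer constant in two guards, which force the input phase to last e steps.

    No universal machine is needed.  If a recursive function f decided opacity,
    let h map e to f applied to the code of the automaton obtained from the
    edges coded by e with e as the constant.  Compile h into a machine that halts
    when the result is positive, and feed it with the code of the edges of its
    own automaton: this automaton is opaque if and only if it is not. *)

Set Implicit Arguments.
Unset Strict Implicit.
Unset Printing Implicit Defensive.

Import Order.TTheory GRing.Theory Num.Theory.

(** * From recursive functions to counter machines *)

Definition store := nat -> nat.

Definition upd (s : store) r x : store := fun i => if i == r then x else s i.

Inductive prog :=
| Skip
| Incr of nat
| Seqp of prog & prog
(* while the register is nonzero, decrement it and run the body *)
| Loop of nat & prog.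

Inductive exec : prog -> store -> store -> Prop :=
| ExecSkip s : exec Skip s s
| ExecIncr r s : exec (Incr r) s (upd s r (s r).+1)
| ExecSeq p q s1 s2 s3 : exec p s1 s2 -> exec q s2 s3 -> exec (Seqp p q) s1 s3
| ExecLoop0 r p s : s r = 0 -> exec (Loop r p) s s
| ExecLoopS r p s s1 s2 : 0 < s r -> exec p (upd s r (s r).-1) s1 ->
    exec (Loop r p) s1 s2 -> exec (Loop r p) s s2.

Lemma updE s r x i : upd s r x i = if i == r then x else s i.
Proof. by []. Qed.

Ltac store_cases :=
  repeat (match goal with |- context [?x == ?y] =>
            case: (eqVneq x y) => ?; [try subst|] end; try (exfalso; lia)).
Ltac store_eq := apply: funext => ?; rewrite /upd; store_cases; rewrite /=; try lia.

Lemma upd_same s r : upd s r (s r) = s.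
Proof. by store_eq. Qed.

Definition clear r := Loop r Skip.

Lemma exec_clear s r : exec (clear r) s (upd s r 0).
Proof.
move E : (s r) => n; elim: n s E => [|n IH] s E.
  by rewrite -E upd_same; apply: ExecLoop0.
apply: ExecLoopS; [by rewrite E | exact: ExecSkip |].
rewrite E /=; have -> : upd s r 0 = upd (upd s r n) r 0 by store_eq.
by apply: IH; rewrite updE eqxx.
Qed.

Definition move a b := Loop a (Incr b).

Lemma exec_move s a b : a != b ->
  exec (move a b) s (upd (upd s b (s b + s a)) a 0).
Proof.
move=> nab; move E : (s a) => n; elim: n s E => [|n IH] s E.
  by rewrite addn0 upd_same -E upd_same; apply: ExecLoop0.
apply: ExecLoopS; [by rewrite E | exact: ExecIncr |].
rewrite E /=; set s1 := upd (upd s a n) b _.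
have -> : upd (upd s b (s b + n.+1)) a 0 = upd (upd s1 b (s1 b + n)) a 0.
  by rewrite /s1; store_eq.
by apply: IH; rewrite /s1 !updE (negPf nab) eqxx.
Qed.

(** A register can only be read by emptying it, so [a] is poured into [b] and [t] together and then
    restored from [t]. *)
Definition copy a b t := Seqp (Loop a (Seqp (Incr b) (Incr t))) (move t a).

Lemma exec_copy s a b t : a != b -> a != t -> b != t -> s b = 0 -> s t = 0 ->
  exec (copy a b t) s (upd s b (s a)).
Proof.
move=> ab at_ bt sb st.
have H1 : forall n s, s a = n ->
    exec (Loop a (Seqp (Incr b) (Incr t))) s
      (upd (upd (upd s b (s b + n)) t (s t + n)) a 0).
  elim=> [|n IH] {sb st}s E.
    rewrite !addn0 -E; set s' := upd _ _ _.
    have -> : s' = s by rewrite /s'; store_eq.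
    by apply: ExecLoop0.
  apply: ExecLoopS; first by rewrite E.
    by apply: ExecSeq; apply: ExecIncr.
  rewrite E /=; set s1 := upd _ t _; set s2 := upd _ a 0.
  suff -> : s2 = upd (upd (upd s1 b (s1 b + n)) t (s1 t + n)) a 0.
    by apply: IH; rewrite /s1 !updE (negPf ab) (negPf at_) eqxx.
  by rewrite /s1 /s2; store_eq.
apply: ExecSeq; first exact: H1.
set s1 := upd _ a 0.
have ta : t != a by rewrite eq_sym.
have := exec_move s1 ta.
by congr exec; rewrite /s1; store_eq.
Qed.

(** * Compilation of recursive functions into loop programs *)

Definition seqs (ps : seq prog) := foldr Seqp Skip ps.

Definition ins_cons k (a : nat) (ins : 'I_k -> nat) (i : 'I_k.+1) : nat :=
  if unlift ord0 i is Some j then ins j else a.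

(* Registers from b on are scratch: zero before and after. *)
Fixpoint compile k (f : recfun k) : ('I_k -> nat) -> nat -> nat -> prog :=
  match f in recfun k return ('I_k -> nat) -> nat -> nat -> prog with
  | RZero _ => fun _ _ _ => Skip
  | RSucc => fun ins o b => Seqp (copy (ins ord0) o b) (Incr o)
  | RProj _ i => fun ins o b => copy (ins i) o b
  | RComp _ m f g => fun ins o b =>
      Seqp (seqs [seq compile (g i) ins (b + i) (b + m) | i <- enum 'I_m])
      (Seqp (compile f (fun i : 'I_m => b + i) o (b + m))
            (seqs [seq clear (b + val i) | i <- enum 'I_m]))
  | RPrim k f g => fun ins o b =>
      let v := fun i : 'I_k => ins (lift ord0 i) in
      Seqp (copy (ins ord0) b (b + 1))
      (Seqp (compile f v (b + 2) (b + 4))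
      (Seqp (Loop b (Seqp (compile g (ins_cons (b + 1) (ins_cons (b + 2) v))
                             (b + 3) (b + 4))
                    (Seqp (clear (b + 2))
                    (Seqp (move (b + 3) (b + 2)) (Incr (b + 1))))))
      (Seqp (clear (b + 1)) (move (b + 2) o))))
  | RMu _ f => fun ins o b =>
      let p := compile f (ins_cons o ins) b (b + 1) in
      Seqp p (Loop b (Seqp (clear b) (Seqp (Incr o) p)))
  end.

(** One direction suffices: programs are only run where the function has a value, and determinism of
    the machine excludes any other outcome. *)
Definition compile_correct k (f : recfun k) := forall ins o b s v y,
  (forall i, ins i < b) -> (forall i, ins i != o) -> o < b ->
  (forall i, s (ins i) = tnth v i) -> s o = 0 -> (forall r, b <= r -> s r = 0) ->
  computes f v y -> exec (compile f ins o b) s (upd s o y).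

Lemma compile_zero k : compile_correct (RZero k).
Proof.
move=> ins o b s v y _ _ _ _ so _ /= ->.
by rewrite -so upd_same; apply: ExecSkip.
Qed.

Lemma compile_proj k i : @compile_correct k (RProj i).
Proof.
move=> ins o b s v y insb inso ob sv so sb /= ->; rewrite -sv.
apply: exec_copy => //; last by apply: sb.
- by have := insb i; lia.
- by lia.
Qed.

Lemma compile_succ : compile_correct RSucc.
Proof.
move=> ins o b s v y insb inso ob sv so sb /= ->.
apply: ExecSeq.
  apply: exec_copy => //; last exact: sb.
  - by have := insb ord0; lia.
  - by lia.
have -> : upd s o (thead v).+1 =
  upd (upd s o (s (ins ord0))) o (upd s o (s (ins ord0)) o).+1.
  by store_eq; rewrite sv.
exact: ExecIncr.
Qed.

(** The output register holds the current candidate and [b] the value of [f] there, so the loop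
    stops at the first zero. The induction in [loop] is on the distance from the candidate to
    [y]. *)
Lemma compile_mu k (f : recfun k.+1) : compile_correct f -> compile_correct (RMu f).
Proof.
move=> IH ins o b s v y insb inso ob sv so sb [/= y0 yS].
have run : forall i z, computes f [tuple of i :: v] z ->
    exec (compile f (ins_cons o ins) b (b + 1)) (upd s o i) (upd (upd s o i) b z).
  move=> i z Hz; apply: IH Hz.
  - by move=> j; rewrite /ins_cons; case: unliftP => [j'|] _;
      [have := insb j' | ]; lia.
  - by move=> j; rewrite /ins_cons; case: unliftP => [j'|] _;
      [have := insb j' | ]; lia.
  - by lia.
  - move=> j; rewrite /ins_cons; case: unliftP => [j' ->|->].
      by rewrite updE (negPf (inso j')) sv tnthS.
    by rewrite updE eqxx tnth0.
  - by rewrite updE sb //; case: eqP => //; lia.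
  - by move=> r br; rewrite updE sb; [case: eqP => //; lia | lia].
have loop : forall n i z, i + n = y -> computes f [tuple of i :: v] z ->
   exec (Loop b (Seqp (clear b) (Seqp (Incr o) (compile f (ins_cons o ins) b (b + 1)))))
     (upd (upd s o i) b z) (upd s o y).
  elim=> [|n IHn] i z iy Hz.
    move: iy; rewrite addn0 => iy; subst i.
    have -> : z = 0 by apply: computes_inj Hz y0.
    have -> : upd (upd s o y) b 0 = upd s o y by store_eq; rewrite sb.
    by apply: ExecLoop0; rewrite updE sb //; case: eqP => //; lia.
  have [z' Hz'] : exists z, computes f [tuple of i.+1 :: v] z.
    have [yi|iy'|->] := ltngtP i.+1 y; [|lia|by exists 0].
    by have [z' ?] := yS _ yi; exists z'.+1.
  have /yS [z1 Hz1] : i < y by lia.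
  rewrite (computes_inj Hz Hz1); apply: ExecLoopS; first by rewrite updE eqxx.
    apply: ExecSeq; first exact: exec_clear.
    apply: ExecSeq; first exact: ExecIncr.
    set s1 := upd _ o _; have -> : s1 = upd s o i.+1.
      rewrite /s1; apply: funext => j; rewrite /upd.
      do ?case: eqVneq => //= *; subst; try lia.
      by rewrite sb.
    exact: run Hz'.
  by apply: IHn => //; lia.
have [z Hz] : exists z, computes f [tuple of 0 :: v] z.
  case: y y0 yS {loop} => [|y] y0 yS; first by exists 0.
  by have [//|z Hz] := yS 0; exists z.+1.
have E0 : s = upd s o 0 by rewrite -so upd_same.
apply: ExecSeq; first by rewrite {1}E0; apply: run Hz.
exact: loop Hz.
Qed.

Lemma compile_prim k (f : recfun k) (g : recfun k.+2) :
  compile_correct f -> compile_correct g -> compile_correct (RPrim f g).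
Proof.
move=> IHf IHg ins o b s v y insb inso ob sv so sb [h [h0 hS ->]] /=.
set rest := fun i : 'I_k => _.
have restE i : s (rest i) = tnth (behead_tuple v) i by rewrite sv tnth_behead -lift0 inord_val.
have restb i : rest i < b by exact: insb.
have resto i : rest i != o by exact: inso.
(* Loop invariant: [b] counts the iterations left, [b + 1] holds the index and [b + 2] the value of
   [h] at this index; [b + 3] receives the next value and is emptied again. *)
pose st c i x := upd (upd (upd s b c) (b + 1) i) (b + 2) x.
have sbE j : s (b + j) = 0 by apply: sb; lia.
apply: (@ExecSeq _ _ _ (st (thead v) 0 0)).
  have -> : st (thead v) 0 0 = upd s b (s (ins ord0)).
    by rewrite /st sv; store_eq; rewrite ?sbE.
  by apply: exec_copy; rewrite ?sbE // ?sb //; have := insb ord0; lia.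
apply: (@ExecSeq _ _ _ (st (thead v) 0 (h 0))).
  have -> : st (thead v) 0 (h 0) = upd (st (thead v) 0 0) (b + 2) (h 0).
    by rewrite /st; store_eq.
  apply: IHf h0.
  - by move=> i; have := restb i; lia.
  - by move=> i; have := restb i; lia.
  - by lia.
  - move=> i; rewrite -restE /st /upd; have ? := restb i.
    by store_cases.
  - by rewrite /st /upd; store_cases.
  - by move=> r br; rewrite /st /upd; store_cases; apply: sb; lia.
apply: (@ExecSeq _ _ _ (st 0 (thead v) (h (thead v)))).
  have : forall n i, i + n = thead v ->
    exec (Loop b
       (Seqp (compile g (ins_cons (b + 1) (ins_cons (b + 2) rest)) (b + 3) (b + 4))
          (Seqp (clear (b + 2)) (Seqp (move (b + 3) (b + 2)) (Incr (b + 1))))))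
      (st n i (h i)) (st 0 (thead v) (h (thead v))).
    elim=> [|n IHn] i iv.
      rewrite addn0 in iv; rewrite iv; apply: ExecLoop0.
      by rewrite /st /upd; store_cases.
    apply: (@ExecLoopS _ _ _ (st n i.+1 (h i.+1))); first by rewrite /st /upd; store_cases.
      have -> : upd (st n.+1 i (h i)) b (st n.+1 i (h i) b).-1 = st n i (h i).
        by rewrite /st; store_eq.
      have /hS Hg : i < thead v by lia.
      apply: ExecSeq.
        apply: IHg Hg.
        - move=> j; rewrite /ins_cons; case: unliftP => [j' _|_]; last lia.
          by case: unliftP => [j'' _|_]; [have := restb j'' |]; lia.
        - move=> j; rewrite /ins_cons; case: unliftP => [j' _|_]; last lia.
          by case: unliftP => [j'' _|_]; [have := restb j'' |]; lia.
        - by lia.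
        - move=> j; rewrite /ins_cons; case: unliftP => [j' ->|->].
            rewrite tnthS; case: unliftP => [j'' ->|->].
              rewrite tnthS -restE /st /upd; have ? := restb j''.
              by store_cases.
            by rewrite tnth0 /st /upd; store_cases.
          by rewrite tnth0 /st /upd; store_cases.
        - by rewrite /st /upd; store_cases; rewrite sbE.
        - by move=> r br; rewrite /st /upd; store_cases; apply: sb; lia.
      apply: ExecSeq; first exact: exec_clear.
      apply: ExecSeq; first by apply: exec_move; lia.
      set s1 := upd _ (b + 3) 0.
      suff -> : st n i.+1 (h i.+1) = upd s1 (b + 1) (s1 (b + 1)).+1 by exact: ExecIncr.
      by rewrite /s1 /st; store_eq; rewrite ?sbE; lia.
    by apply: IHn; lia.
  by move/(_ (thead v) 0); apply.
apply: ExecSeq; first exact: exec_clear.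
set s1 := upd _ (b + 1) 0.
have nbo : b + 2 != o by lia.
have := exec_move s1 nbo; congr exec.
by rewrite /s1 /st; store_eq; rewrite ?sbE ?so ?sb //; lia.
Qed.

(** [S u] is the store expected after the programs of the prefix [u], so that each program can be
    treated on its own. *)
Lemma exec_seqs (I : eqType) (P : I -> prog) (S : seq I -> store) (r : seq I) :
  (forall u i v, r = u ++ i :: v -> exec (P i) (S u) (S (rcons u i))) ->
  exec (seqs [seq P i | i <- r]) (S [::]) (S r).
Proof.
move=> H; have : forall v u, r = u ++ v -> exec (seqs [seq P i | i <- v]) (S u) (S r).
  elim=> [|i v IH] u E; first by rewrite E cats0; apply: ExecSkip.
  apply: ExecSeq; first exact: H E.
  by apply: IH; rewrite cat_rcons.
exact.
Qed.

Lemma compile_comp k m (f : recfun m) (g : 'I_m -> recfun k) :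
  compile_correct f -> (forall i, compile_correct (g i)) -> compile_correct (RComp f g).
Proof.
move=> IHf IHg ins o b s v y insb inso ob sv so sb [w Hg Hf] /=.
(* The store once the [g i] with [i] in [u] are evaluated: their values are in [b + i], and the rest
   is as in [s]. *)
pose st (u : seq 'I_m) : store := fun r =>
  if [pick i : 'I_m | (b + i == r) && (i \in u)] is Some i then tnth w i else s r.
have stlt u r : r < b -> st u r = s r.
  by rewrite /st; case: pickP => // i /andP[/eqP <- _]; lia.
have stge u r : b + m <= r -> st u r = 0.
  by rewrite /st; case: pickP => [i /andP[/eqP <- _]|_ ?]; [have := ltn_ord i|apply: sb]; lia.
have stin u (i : 'I_m) : st u (b + i) = if i \in u then tnth w i else 0.
  rewrite /st; case: pickP => [j /andP[/eqP/addnI/val_inj -> ->//]|/(_ i)].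
  by rewrite eqxx /= => ->; apply: sb; lia.
have st_rcons u i : st (rcons u i) = upd (st u) (b + i) (tnth w i).
  apply: funext => r; rewrite /upd; case: eqVneq => [->|nr].
    by rewrite stin mem_rcons inE eqxx.
  rewrite /st; congr (if _ is Some _ then _ else _); apply: eq_pick => j /=.
  rewrite mem_rcons inE; case: (eqVneq j i) => [->|//].
  by rewrite eq_sym (negPf nr).
have st0 : st [::] = s.
  by apply: funext => r; rewrite /st; case: pickP => // i; rewrite andbF.
apply: (@ExecSeq _ _ _ (st (enum 'I_m))).
  rewrite -{1}st0; apply: (@exec_seqs _ (fun i : 'I_m => compile (g i) ins (b + i) (b + m))).
  move=> u i u' E.
  have iu : i \notin u.
    have := enum_uniq 'I_m; rewrite E cat_uniq /= negb_or.
    by case/and3P => _ /andP[].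
  rewrite st_rcons; apply: IHg (Hg i).
  - by move=> j; have := insb j; lia.
  - by move=> j; have := insb j; lia.
  - by have := ltn_ord i; lia.
  - by move=> j; rewrite stlt.
  - by rewrite stin (negPf iu).
  - exact: stge.
apply: (@ExecSeq _ _ _ (upd (st (enum 'I_m)) o y)).
  apply: IHf Hf.
  - by move=> i; have := ltn_ord i; lia.
  - by move=> i; lia.
  - by lia.
  - by move=> i; rewrite stin mem_enum.
  - by rewrite stlt.
  - exact: stge.
pose st' (u : seq 'I_m) : store := fun r =>
  if [pick i : 'I_m | (b + i == r) && (i \in u)] is Some i then 0
  else upd (st (enum 'I_m)) o y r.
have := @exec_seqs _ (fun i : 'I_m => clear (b + i)) st' (enum 'I_m).
have -> : st' [::] = upd (st (enum 'I_m)) o y.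
  by apply: funext => r; rewrite /st'; case: pickP => // i; rewrite andbF.
have -> : st' (enum 'I_m) = upd s o y.
  apply: funext => r; rewrite /st'; case: pickP => [i /andP[/eqP <- _]|nr].
    by rewrite updE sb; [case: eqP => //; lia | lia].
  rewrite !updE; case: eqP => // _; rewrite /st; case: pickP => // i.
  by rewrite nr.
apply=> u i u' _; suff -> : st' (rcons u i) = upd (st' u) (b + i) 0 by exact: exec_clear.
apply: funext => r; rewrite /upd /st'; case: eqVneq => [->|nr].
  by case: pickP => // /(_ i); rewrite mem_rcons inE !eqxx.
set p1 := pick _; set p2 := pick _; suff -> : p1 = p2 by [].
apply: eq_pick => j /=.
rewrite mem_rcons inE; case: (eqVneq j i) => [->|//].
by rewrite eq_sym (negPf nr).
Qed.

Lemma compileP k (f : recfun k) : compile_correct f.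
Proof.
elim: f => {k}.
- exact: compile_zero.
- exact: compile_succ.
- exact: compile_proj.
- by move=> k m f IHf g IHg; apply: compile_comp.
- by move=> k f IHf g IHg; apply: compile_prim.
- by move=> k f IHf; apply: compile_mu.
Qed.

(** * Deterministic counter machines and the flattening of programs *)

Inductive op := Inc of nat | Dec of nat | Zero of nat | Nop | Halt.

Definition nat2_of_op o :=
  match o with
  | Inc r => (0, r) | Dec r => (1, r) | Zero r => (2, r) | Nop => (3, 0) | Halt => (4, 0)
  end.

Definition op_of_nat2 x :=
  match x with
  | (0, r) => Inc r | (1, r) => Dec r | (2, r) => Zero r | (3, _) => Nop | _ => Halt
  end.

Lemma nat2_of_opK : cancel nat2_of_op op_of_nat2.
Proof. by case. Qed.

HB.instance Definition _ := Countable.copy op (can_type nat2_of_opK).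

Definition trans : Type := (nat * op * nat)%type.

Definition eff (o : op) (s s' : store) : Prop :=
  match o with
  | Inc r => s' = upd s r (s r).+1
  | Dec r => 0 < s r /\ s' = upd s r (s r).-1
  | Zero r => s r = 0 /\ s' = s
  | Nop => s' = s
  | Halt => False
  end.

Definition inp : trans := (1, Inc 0, 1).
Definition go : trans := (1, Nop, 2).

(* The first component of a configuration is the number of steps since the
   start plus one: [inp] is repeated exactly [e] times before [go]. *)
Definition mconf : Type := (nat * nat * store)%type.

Definition mstep (Pr : seq trans) e (c c' : mconf) : Prop :=
  exists t : trans, [/\ t \in Pr, t.1.1 = c.1.2,
    c'.1 = (c.1.1.+1, t.2), eff t.1.2 c.2 c'.2
    & (t = go -> e < c.1.1) /\ (t = inp -> c.1.1 <= e)].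

Inductive star T (r : T -> T -> Prop) : T -> T -> Prop :=
| StarRefl x : star r x x
| StarStep x y z : r x y -> star r y z -> star r x z.

Lemma star_trans T (r : T -> T -> Prop) x y z : star r x y -> star r y z -> star r x z.
Proof. by elim=> // {}x x' y' rxx' _ IH /IH; apply: StarStep. Qed.

Lemma star_normal_unique T (r : T -> T -> Prop) x y z :
  (forall a b c, r a b -> r a c -> b = c) ->
  star r x y -> star r x z -> (forall a, ~ r y a) -> (forall a, ~ r z a) -> y = z.
Proof.
move=> det xy; elim: xy z => [{}x|{}x x' y' rx _ IH] z.
  by case=> // ? ? ? H _ /(_ _ H).
move=> st ny; case: st rx => [w rw /(_ _ rw)//|w w' z' rw sw rx nz].
by apply: IH => //; rewrite -(det _ _ _ rw rx).
Qed.

Fixpoint psize p :=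
  match p with
  | Skip => 0
  | Incr _ => 1
  | Seqp p q => psize p + psize q
  | Loop _ p => psize p + 2
  end.

(** The code of [p] occupies the [psize p] states from [b] on and is left in state [b + psize p]. A
    loop tests in state [b], has its body from [b + 1] on, and jumps back from the state after the
    body. *)
Fixpoint flat p b : seq trans :=
  match p with
  | Skip => [::]
  | Incr r => [:: (b, Inc r, b + 1)]
  | Seqp p q => flat p b ++ flat q (b + psize p)
  | Loop r p =>
    [:: (b, Dec r, b + 1); (b, Zero r, b + (psize p + 2)); (b + 1 + psize p, Nop, b)]
      ++ flat p (b + 1)
  end.

Lemma mstep_of Pr e k s s' (t : trans) : t \in Pr -> 1 < t.1.1 -> eff t.1.2 s s' ->
  mstep Pr e (k, t.1.1, s) (k.+1, t.2, s').
Proof. by move=> tPr t1 ts; exists t; split=> //; split=> Et; rewrite Et in t1. Qed.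

Lemma exec_flat Pr e p s s' b k : exec p s s' -> 1 < b -> {subset flat p b <= Pr} ->
  exists k', star (mstep Pr e) (k, b, s) (k', b + psize p, s').
Proof.
move=> ex; elim: ex b k => {p s s'}.
- by move=> s b k _ _; exists k; rewrite addn0; apply: StarRefl.
- move=> r s b k b1 sub; exists k.+1; apply: StarStep (StarRefl _ _).
  by apply: (@mstep_of _ _ _ _ _ (b, Inc r, b + 1)) => //; apply: sub; rewrite inE.
- move=> p q s1 s2 s3 _ IH1 _ IH2 b k b1 sub.
  have [|k1 H1] := IH1 b k b1; first by move=> t tp; apply: sub; rewrite /= mem_cat tp.
  have [||k2 H2] := IH2 (b + psize p) k1; first by lia.
    by move=> t tp; apply: sub; rewrite /= mem_cat tp orbT.
  by exists k2; rewrite /= addnA; apply: star_trans H1 H2.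
- move=> r p s s0 b k b1 sub; exists k.+1; apply: StarStep (StarRefl _ _).
  apply: (@mstep_of _ _ _ _ _ (b, Zero r, b + (psize p + 2))) => //=.
  by apply: sub; rewrite !inE eqxx orbT.
- move=> r p s s1 s2 s0 _ IH1 _ IH2 b k b1 sub.
  have [||k1 H1] := IH1 (b + 1) k.+1; first by lia.
    by move=> t tp; apply: sub; rewrite /= !inE tp !orbT.
  have [k2 H2] := IH2 b k1.+1 b1 sub.
  exists k2; apply: StarStep (star_trans H1 (StarStep _ H2)).
    apply: (@mstep_of _ _ _ _ _ (b, Dec r, b + 1)) => //=.
    by apply: sub; rewrite !inE eqxx.
  apply: (@mstep_of _ _ _ _ _ (b + 1 + psize p, Nop, b)) => //=; last by lia.
  by apply: sub; rewrite !inE eqxx !orbT.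
Qed.

(** Transitions that share a source may only be the two outcomes of a test of one register, so they
    are never enabled together. *)
Definition exclusive (t t' : trans) : Prop :=
  t.1.1 = t'.1.1 -> t = t' \/ exists r,
    t.1.2 = Dec r /\ t'.1.2 = Zero r \/ t.1.2 = Zero r /\ t'.1.2 = Dec r.

Lemma flat_src p b (t : trans) : t \in flat p b -> b <= t.1.1 < b + psize p.
Proof.
elim: p b => //= [r|p IHp q IHq|r p IHp] b.
- by rewrite inE => /eqP -> /=; lia.
- by rewrite mem_cat => /orP[/IHp|/IHq]; lia.
- by rewrite !inE => /or4P[/eqP->|/eqP->|/eqP->|/IHp] /=; lia.
Qed.

Lemma flat_exclusive p b : {in flat p b &, forall t t', exclusive t t'}.
Proof.
elim: p b => //= [r|p IHp q IHq|r p IHp] b t t'.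
- by rewrite !inE => /eqP-> /eqP-> _; left.
- rewrite !mem_cat => /orP[] H /orP[] H'; do ?[exact: IHp H H'|exact: IHq H H'];
  by move: (flat_src H) (flat_src H') => ? ? ?; lia.
- rewrite !inE => /or4P[/eqP->|/eqP->|/eqP->|H] /or4P[/eqP->|/eqP->|/eqP->|H'];
  rewrite /exclusive /=; do ?[by left|exact: IHp H H'];
  try (by right; exists r; auto);
  try (have := flat_src H); try (have := flat_src H'); lia.
Qed.

Section Machine.
Variable p : prog.

Definition exit_state := 2 + psize p.

(** After [p], the decrement of the output register 1 gives access to [Halt] exactly when the result
    is positive. *)
Definition machine : seq trans :=
  [:: go; inp; (exit_state, Dec 1, exit_state.+1); (exit_state.+1, Halt, exit_state.+2)]
    ++ flat p 2.

(** In state 1 the step count, compared with [e], decides between [go] and [inp]; elsewhere only a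
    [Dec] and a [Zero] of one register compete, and its content decides. *)
Lemma mstep_det e c c1 c2 : mstep machine e c c1 -> mstep machine e c c2 -> c1 = c2.
Proof.
case: c c1 c2 => [[k q] s] [kq1 s1] [kq2 s2].
move=> [t [tP /= tq -> ts [tgo tinp]]] [t' [tP' /= tq' -> ts' [tgo' tinp']]].
have ex : exclusive t t' -> (k.+1, t.2, s1) = (k.+1, t'.2, s2).
  move/(_ (etrans tq (esym tq'))) => [E|[r]].
    subst t'; congr (_, _, _); case: (t.1.2) ts ts' => /=.
    - by move=> r -> ->.
    - by move=> r [_ ->] [_ ->].
    - by move=> r [_ ->] [_ ->].
    - by move=> -> ->.
    - by [].
  by case=> -[Et Et']; move: ts ts'; rewrite Et Et' /=; lia.
rewrite {}/exclusive in ex.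
move: tP tP'; rewrite !inE.
case/or4P => [/eqP Et|/eqP Et|/eqP Et|/orP[/eqP Et|Ht]];
case/or4P => [/eqP Et'|/eqP Et'|/eqP Et'|/orP[/eqP Et'|Ht']];
  try (by apply: ex => _; left; rewrite Et Et');
  try (by apply: ex; apply: flat_exclusive Ht Ht');
  try (have := flat_src Ht); try (have := flat_src Ht');
  subst; rewrite /exit_state /= in tq' tgo tgo' tinp tinp' *; try lia;
  try (have := tgo erefl); try (have := tinp erefl);
  try (have := tgo' erefl); try (have := tinp' erefl); lia.
Qed.

(** [Halt] is never executed, its effect being [False]: halting means reaching a state from which
    such a transition starts. *)
Definition halts e := exists k s q q', star (mstep machine e) (1, 1, fun=> 0) (k, q, s)
  /\ (q, Halt, q') \in machine.

Lemma machine_input e : star (mstep machine e) (1, 1, fun=> 0) (e.+2, 2, upd (fun=> 0) 0 e).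
Proof.
have : forall n i, i + n = e ->
    star (mstep machine e) (i.+1, 1, upd (fun=> 0) 0 i) (e.+2, 2, upd (fun=> 0) 0 e).
  elim=> [|n IH] i ie.
    rewrite addn0 in ie; subst i; apply: StarStep (StarRefl _ _).
    by exists go; split.
  apply: StarStep (IH i.+1 _); last by lia.
  by exists inp; split=> //=; [store_eq | split=> // _; lia].
move/(_ e 0 erefl); have -> // : upd (fun=> 0) 0 0 = (fun=> 0) by store_eq.
Qed.

(** The run of [p] ends in the exit state, where decrementing register 1 is the only way on. If this
    register is zero the machine is stuck there, and by determinism it cannot get stuck at [Halt]
    instead. *)
Lemma halts_exec e s : exec p (upd (fun=> 0) 0 e) s -> halts e <-> 0 < s 1.
Proof.
move=> ex.
have [||k run] := exec_flat e (Pr := machine) (b := 2) e.+2 ex; first by [].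
  by move=> t tp; rewrite mem_cat tp orbT.
have {}run := star_trans (machine_input e) run.
have haltP k' s' c : ~ mstep machine e (k', exit_state.+1, s') c.
  move=> [t [+ /= tq _ ts _]]; rewrite !inE.
  case/or4P => [/eqP Et|/eqP Et|/eqP Et|/orP[/eqP Et|/flat_src]];
    try subst t; rewrite /exit_state /= in tq ts *; lia.
split=> [[k' [s' [q [q' [run' hq]]]]]|s1].
  have Eq : q = exit_state.+1.
    move: hq; rewrite !inE => /or4P[/eqP|/eqP|/eqP|/orP[/eqP[->]|]] //.
    have : forall p b, (q, Halt, q') \notin flat p b.
      elim=> //= [r|p1 IH1 q1 IH2|r p1 IH1] b; first by rewrite inE; apply/negP => /eqP.
        by rewrite mem_cat negb_or IH1 IH2.
      by rewrite !inE (negPf (IH1 _)); apply/negP => /or4P[/eqP|/eqP|/eqP|].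
    by move/(_ p 2)/negPf->.
  subst q; case: (posnP (s 1)) => // s1.
  have := star_normal_unique (@mstep_det e) run' run _ _.
  have nr : forall a, ~ mstep machine e (k, 2 + psize p, s) a.
    move=> c [t [+ /= tq _ ts _]]; rewrite !inE.
    case/or4P => [/eqP Et|/eqP Et|/eqP Et|/orP[/eqP Et|/flat_src]];
      try subst t; rewrite /exit_state /= in tq ts *; lia.
  by move=> /(_ (fun c => @haltP _ _ c) nr) [_]; rewrite /exit_state; lia.
exists k.+1, (upd s 1 (s 1).-1), exit_state.+1, exit_state.+2; split; last first.
  by rewrite !inE eqxx !orbT.
apply: star_trans run (StarStep _ (StarRefl _ _)).
exists (exit_state, Dec 1, exit_state.+1); split=> //=.
by rewrite !inE eqxx !orbT.
Qed.

End Machine.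

Lemma halts_compile (f : recfun 1) e y : computes f [tuple e] y ->
  halts (compile f (fun=> 0) 1 2) e <-> 0 < y.
Proof.
move=> fy; rewrite (@halts_exec _ _ (upd (upd (fun=> 0) 0 e) 1 y)) //.
by apply: compileP fy => // [i|[|[]]//]; rewrite ord1.
Qed.

(** * Runs of a counter machine as timed words *)

(* A configuration is written in a unit time interval opened by a marker
   [Mk t], where [t] is the next transition; a unit of register [j] is an event
   [Keep j], or [Del j] if [t] removes it, and [New j] is a unit added by [t]. *)
Inductive letter := Keep of nat | New of nat | Del of nat | Start | Mk of trans.

Definition code_letter a : (nat * nat) + option trans :=
  match a with
  | Keep j => inl (0, j) | New j => inl (1, j) | Del j => inl (2, j)
  | Start => inr None | Mk t => inr (Some t)
  end.

Definition decode_letter x :=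
  match x with
  | inl (0, j) => Keep j | inl (1, j) => New j | inl (_, j) => Del j
  | inr None => Start | inr (Some t) => Mk t
  end.

Lemma code_letterK : cancel code_letter decode_letter.
Proof. by case. Qed.

HB.instance Definition _ := Countable.copy letter (can_type code_letterK).

Definition marker a := match a with Start | Mk _ => true | _ => false end.

(* The register in which [a] counts one before, resp. after, the transition. *)
Definition before a := match a with Keep j | Del j => Some j | _ => None end.
Definition after a := match a with Keep j | New j => Some j | _ => None end.

(** The events allowed exactly one time unit apart: a marker after a marker, a unit of the same
    register after a unit that survives, and after a [Del] only a [New]. *)
Definition follows a b := (marker a == marker b) && (after a == before b).
Definition needs_next a := marker a || (after a != None).

(* [None] is the initial state and [Some None] the state after [Start]; in
   [Some (Some (b, t))] the last marker is [Mk t], and [b] tells whether the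
   event [New] or [Del] required by [t] is still awaited. *)
Definition mstate : Type := option (option (bool * trans)).

Definition enter (t : trans) : mstate :=
  Some (Some (match t.1.2 with Inc _ | Dec _ => true | _ => false end, t)).

(** The untimed conditions: consecutive transitions fit together, [t] gets exactly the [New] or
    [Del] that it requires, a register tested for zero has no unit, and nothing comes after
    [Halt]. *)
Definition delta (s : mstate) (a : letter) : option mstate :=
  match s, a with
  | None, Start => Some (Some None)
  | Some None, Mk t => if t.1.1 == 1 then Some (enter t) else None
  | Some (Some (b, t)), Keep j =>
    if (t.1.2 == Halt) || (t.1.2 == Zero j) then None else Some s
  | Some (Some (b, t)), New j =>
    if b && (t.1.2 == Inc j) then Some (Some (Some (false, t))) else None
  | Some (Some (b, t)), Del j =>
    if b && (t.1.2 == Dec j) then Some (Some (Some (false, t))) else None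
  | Some (Some (b, t)), Mk t' =>
    if [&& ~~ b, t.1.2 != Halt & t'.1.1 == t.2] then Some (enter t') else None
  | _, _ => None
  end.

Definition accepting (s : mstate) :=
  if s is Some (Some (_, t)) then t.1.2 == Halt else false.

Fixpoint monitor (s : mstate) (w : seq letter) : bool :=
  if w is a :: w' then if delta s a is Some s' then monitor s' w' else false
  else accepting s.

(** * From error-free words to halting runs *)

Section Words.
Variables (R : realType) (Pr : seq trans) (e : nat).
Local Notation word := (seq (letter * R)).
Local Open Scope ring_scope.
Implicit Types (w u v : word) (p : letter * R).

Definition tsorted : word -> bool := pairwise (fun p p' => p.2 < p'.2).

(** Each field excludes errors that the automaton can detect. [ef_next] demands a copy only if the
    word goes on past its time, and [ef_gap] demands an original only if some event precedes its
    time: a detecting run has to read these events. *)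
Record error_free w : Prop := ErrorFree {
  ef_sorted : tsorted w;
  ef_monitor : monitor None [seq p.1 | p <- w];
  ef_follows : forall a b t, (a, t) \in w -> (b, t + 1) \in w -> follows a b;
  ef_next : forall a b t t', (a, t) \in w -> (b, t') \in w -> needs_next a ->
    t + 1 < t' -> exists b', (b', t + 1) \in w;
  ef_markers : forall a b t t', (a, t) \in w -> (b, t') \in w ->
    marker a -> marker b -> t < t' -> t + 1 <= t';
  ef_gap : forall a b t t', (a, t) \in w -> (b, t') \in w -> before b != None ->
    t < t' - 1 -> exists a', (a', t' - 1) \in w;
  ef_input : forall t0 v, w = (Start, t0) :: v -> forall t,
    ((Mk go, t) \in v -> t0 + e.+1%:R <= t) /\
    ((Mk inp, t) \in v -> t < t0 + e.+1%:R) }.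

Lemma tsorted_mid u m v : tsorted (u ++ m :: v) ->
  (forall p, p \in u -> p.2 < m.2) /\ (forall p, p \in v -> m.2 < p.2).
Proof.
rewrite /tsorted pairwise_cat /= => /and3P[/allrelP ru _ /andP[/allP rv _]].
by split=> p pu; [apply: ru => //; rewrite mem_head | apply: rv].
Qed.

Lemma in_segment w u m v m' z p : tsorted w -> w = u ++ m :: v ++ m' :: z ->
  p \in w -> m.2 < p.2 -> p.2 < m'.2 -> p \in v.
Proof.
move=> + E; rewrite E => sw; have [um _] := tsorted_mid sw.
have := sw; rewrite -cat_cons catA => /tsorted_mid[_ zm'].
rewrite !(mem_cat, inE) => /orP[/or3P[/um|/eqP->|//]|/orP[/eqP->|/zm']];
  rewrite ?ltxx // => /lt_trans H1 H2 H3.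
- by have := H1 _ H2; rewrite ltxx.
- by have := H1 _ H3; rewrite ltxx.
Qed.

Definition plain_word v := all (fun p => ~~ marker p.1) v.

(** By [ef_markers] the distance is at least one. Were it larger, the event due one time unit after
    the first marker would itself be a marker, strictly between the two. *)
Lemma marker_distance w u m v m' z : error_free w -> w = u ++ m :: v ++ m' :: z ->
  marker m.1 -> marker m'.1 -> plain_word v -> m'.2 = m.2 + 1.
Proof.
case: m m' => [m t] [m' t'] ef E /= mm mm' vp; have sw := ef_sorted ef.
have mw : (m, t) \in w by rewrite E !(mem_cat, inE) eqxx ?orbT.
have mw' : (m', t') \in w by rewrite E !(mem_cat, inE) eqxx ?orbT.
have tt' : t < t'.
  have := sw; rewrite E => /tsorted_mid[_ /(_ (m', t'))]; apply.
  by rewrite !(mem_cat, inE) eqxx ?orbT.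
have := ef_markers ef mw mw' mm mm' tt'; rewrite le_eqVlt => /predU1P[//|lt1].
have [|b bw] := ef_next ef mw mw' _ lt1; first by rewrite /needs_next mm.
have := ef_follows ef mw bw; rewrite /follows mm => /andP[/eqP bm _].
have := in_segment sw E bw; rewrite /= ltrDl ltr01 => /(_ isT lt1) bv.
by have := allP vp _ bv; rewrite /= -bm.
Qed.

Definition cnt (f : letter -> option nat) v : store :=
  fun j => count (fun p => f p.1 == Some j) v.

(** Translation by one is a bijection from the times of the units left by the first block to the
    times of the units found in the second: [ef_next] gives the copies, [ef_gap] the originals. The
    outer markers are the further events that these two conditions ask for. *)
Lemma configuration_copied w u m v m' v' m'' z j : error_free w ->
  w = u ++ m :: v ++ m' :: v' ++ m'' :: z ->
  marker m.1 -> marker m'.1 -> marker m''.1 -> plain_word v -> plain_word v' ->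
  cnt before v' j = cnt after v j.
Proof.
case: m m' m'' => [m t] [m' t'] [m'' t''] ef E mm mm' mm'' vp vp'.
have sw := ef_sorted ef.
have E' : w = (u ++ (m, t) :: v) ++ (m', t') :: v' ++ (m'', t'') :: z.
  by rewrite E -catA.
have /= t'E := marker_distance ef E mm mm' vp.
have /= t''E := marker_distance ef E' mm' mm'' vp'.
have vw p : p \in v -> p \in w by move=> pv; rewrite E !(mem_cat, inE) pv ?orbT.
have vw' p : p \in v' -> p \in w by move=> pv; rewrite E !(mem_cat, inE) pv ?orbT.
have tv p : p \in v -> t < p.2 < t'.
  move=> pv; have := sw; rewrite E => /tsorted_mid[_ /(_ p)].
  rewrite mem_cat pv => /(_ isT) /= ->; have := sw; rewrite E' => /tsorted_mid[/(_ p)].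
  by rewrite mem_cat inE pv !orbT => /(_ isT).
have tv' p : p \in v' -> t' < p.2 < t''.
  move=> pv; have := sw; rewrite E' => /tsorted_mid[_ /(_ p)].
  rewrite mem_cat pv => /(_ isT) /= ->; have := sw.
  rewrite E' -cat_cons catA => /tsorted_mid[/(_ p)].
  by rewrite mem_cat inE pv !orbT => /(_ isT).
have mw : (m, t) \in w by rewrite E !(mem_cat, inE) eqxx ?orbT.
have mw'' : (m'', t'') \in w by rewrite E !(mem_cat, inE) eqxx ?orbT.
pose ts f (x : word) := [seq p.2 | p <- x & f p.1 == Some j].
have tsu f x : tsorted x -> uniq (ts f x).
  move=> sx; suff : pairwise <%R (ts f x) by apply: pairwise_uniq; apply: ltxx.
  rewrite /ts pairwise_map.
  by have := subseq_pairwise (filter_subseq _ x) sx; apply.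
suff /perm_size : perm_eq (ts before v') [seq x + 1 | x <- ts after v].
  by rewrite !size_map !size_filter.
have [sv sv'] : tsorted v /\ tsorted v'.
  by move: sw; rewrite E /tsorted !(pairwise_cat, pairwise_cons) => /and3P[_ _
    /andP[_ /and3P[_ -> /andP[_ /and3P[_ -> _]]]]].
apply: uniq_perm; first exact: tsu.
  by rewrite map_inj_uniq; [exact: tsu | exact: addIr].
move=> x; apply/idP/idP.
  case/mapP => -[b y]; rewrite mem_filter /= => /andP[/eqP bj bv'] ->{x}.
  have /= /andP[ty yt] := tv' _ bv'.
  have [||a aw] := ef_gap ef mw (vw' _ bv'); rewrite ?bj //; first by lra.
  have av : (a, y - 1) \in v by apply: in_segment sw E aw _ _ => /=; lra.
  have := ef_follows ef aw; rewrite subrK => /(_ _ (vw' _ bv')) /andP[_ /eqP ab].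
  apply/mapP; exists (y - 1); rewrite ?subrK //.
  by apply/mapP; exists (a, y - 1); rewrite // mem_filter av ab bj eqxx.
case/mapP => z' /mapP[[a y]]; rewrite mem_filter /= => /andP[/eqP aj av] ->{z'} ->{x}.
have /= /andP[ty yt] := tv _ av.
have [||b bw] := ef_next ef (vw _ av) mw''; first by rewrite /needs_next aj orbT.
  by lra.
have bv' : (b, y + 1) \in v' by apply: in_segment sw E' bw _ _ => /=; lra.
have /andP[_ /eqP ab] := ef_follows ef (vw _ av) bw.
by apply/mapP; exists (b, y + 1); rewrite // mem_filter bv' -ab aj eqxx.
Qed.

(** What the rest of a block still has to do: the whole effect while an event is awaited, and
    nothing afterwards. A zero test awaits no event, which explains the last clause. *)
Definition awaiting_eff (b : bool) (o : op) (s s' : store) : Prop :=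
  if b then eff o s s' else s' = s /\ (forall j, o = Zero j -> s j = 0%N).

Lemma monitor_block b t v : t.1.2 != Halt ->
  monitor (Some (Some (b, t))) [seq p.1 | p <- v] ->
  exists v1 t' x v2, [/\ v = v1 ++ (Mk t', x) :: v2, plain_word v1, t'.1.1 = t.2,
    monitor (enter t') [seq p.1 | p <- v2] &
    awaiting_eff b t.1.2 (cnt before v1) (cnt after v1)].
Proof.
move=> nh; elim: v b => [|[a x] v IH] b /=; first by rewrite (negPf nh).
case: a => [j|j|j||t'] //=.
- rewrite (negPf nh) /=; case: eqP => // nz /IH [v1 [t' [y [v2 [-> pv tt' mv ev]]]]].
  exists ((Keep j, x) :: v1), t', y, v2; split=> //.
  have addE f : f (Keep j) = Some j -> cnt f ((Keep j, x) :: v1) =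
      upd (cnt f v1) j (cnt f v1 j).+1.
    move=> fj; apply: funext => i; rewrite /cnt /= fj /upd.
    case: (eqVneq i j) => [->|ij]; first by rewrite eqxx.
    by rewrite (_ : (Some j == Some i) = false) //; apply/eqP => -[] /esym/eqP; apply/negP.
  rewrite !addE //; move: nz ev; rewrite /awaiting_eff; clear.
  case: b => [|nz [-> zero]].
    case: (t.1.2) => //= [r nz|r nz|r nz|nz].
    + by move=> ->; store_eq.
    + by move=> [r0 ->]; split; [rewrite updE; case: ifP|store_eq].
    + move=> [r0 ->]; split=> //; rewrite updE; case: eqP => // E.
      by rewrite E in nz.
    + by move=> ->.
  split=> // i E; rewrite updE; case: eqP => [ij|_]; last exact: zero.
  by rewrite E ij in nz.
- case: b => //=; case: eqP => // oj /IH [v1 [t' [y [v2 [-> pv tt' mv [ev _]]]]]].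
  exists ((New j, x) :: v1), t', y, v2; split=> //; rewrite /= oj /=.
  apply: funext => i; have := congr1 (fun f => f i) ev; rewrite /cnt /= /upd.
  have [->|ij] := eqVneq i j; first by rewrite eqxx /= => ->.
  rewrite (_ : (Some j == Some i) = false) //.
  by apply/eqP => -[] /esym/eqP; apply/negP.
- case: b => //=; case: eqP => // oj /IH [v1 [t' [y [v2 [-> pv tt' mv [ev _]]]]]].
  exists ((Del j, x) :: v1), t', y, v2; split=> //; rewrite /= oj /=.
  split; first by rewrite /cnt /= eqxx.
  apply: funext => i; have := congr1 (fun f => f i) ev; rewrite /cnt /= /upd.
  have [->|ij] := eqVneq i j; first by rewrite eqxx /= => ->.
  rewrite (_ : (Some j == Some i) = false) //.
  by apply/eqP => -[] /esym/eqP; apply/negP.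
- case: b => //=; rewrite nh /=; case: eqP => // tt' mv.
  by exists [::], t', x, v; split=> //; split.
Qed.

Definition halting_run := exists k s q q',
  star (mstep Pr e) (1%N, 1%N, fun=> 0%N) (k, q, s) /\ (q, Halt, q') \in Pr.

Lemma error_free_halting_run w : (forall t x, (Mk t, x) \in w -> t \in Pr) ->
  error_free w -> halting_run.
Proof.
move=> wPr ef; have := ef_monitor ef.
case E0 : {1}w => [//|[a t0] w1] /=; case: a E0 => // E0.
case E1 : w1 => [//|[a t1] w2] /=; case: a E1 => // t E1.
case: eqP => // tq mt.
(* [k] is both the first component of the machine configuration and the distance of the marker from
   the start. The store is read off the next block only if a marker closes it, since no marker comes
   after [Halt]. *)
have run : forall n u t v x k s, (size v < n)%N -> w = u ++ (Mk t, x) :: v ->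
  x = t0 + k%:R -> (0 < k)%N -> monitor (enter t) [seq p.1 | p <- v] ->
  (forall v1 m v2, v = v1 ++ m :: v2 -> plain_word v1 -> marker m.1 -> s = cnt before v1) ->
  exists k' s' q q', star (mstep Pr e) (k, t.1.1, s) (k', q, s') /\ (q, Halt, q') \in Pr.
  elim=> // n IH {t w2 tq mt E1}u t v x k s vn E xk k0 mv sv.
  have tPr : t \in Pr by apply: (wPr t x); rewrite E mem_cat inE eqxx orbT.
  have [Ht|nHt] := eqVneq t.1.2 Halt.
    exists k, s, t.1.1, t.2; split; first exact: StarRefl.
    by case: t Ht {E mv} tPr => [[q o] q'] /= ->.
  have [v1 [t' [x' [v2 [Ev pv tt' mv' ev]]]]] := monitor_block nHt mv.
  have x'E : x' = x + 1.
    by rewrite Ev in E; have := marker_distance ef E; apply.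
  have sE := sv _ _ _ Ev pv isT.
  have E' : w = (u ++ (Mk t, x) :: v1) ++ (Mk t', x') :: v2 by rewrite E Ev -catA.
  have [||||k' [s' [q [q' [run hq]]]]] :=
      IH _ _ _ _ k.+1 (cnt after v1) _ E' _ _ mv'.
  - by move: vn; rewrite Ev size_cat /=; lia.
  - by rewrite x'E xk -natr1 addrA.
  - by [].
  - move=> v3 m v4 Ev2 pv3 mm; apply: funext => j; apply/esym.
    by rewrite Ev2 in E'; apply: (configuration_copied (m := (Mk t, x))
      (m' := (Mk t', x')) (m'' := m) (u := u) (z := v4) j ef) => //; rewrite E' -catA.
  exists k', s', q, q'; split=> //; apply: StarStep run.
  exists t; split=> //=; first by rewrite tt'.
    move: ev; rewrite -sE; move: nHt; rewrite /enter /awaiting_eff.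
    by case: (t.1.2) => //= [r _ [-> H]|_ [-> _]//]; split=> //; apply: H.
  have xw1 : (Mk t, x) \in w1.
    have : (Mk t, x) \in w by rewrite E mem_cat inE eqxx orbT.
    by rewrite E0 inE => /orP[/eqP[]|].
  (* At time [t0 + k] the bound [t0 + e.+1] amounts to [e < k] for [go] and to [k <= e] for
     [inp]. *)
  have [igo iinp] := ef_input ef E0 x.
  split=> Et; rewrite Et in xw1.
    by have := igo xw1; rewrite xk lerD2l ler_nat.
  by have := iinp xw1; rewrite xk ltrD2l ltr_nat ltnS.
have := run (size w2).+1 [:: (Start, t0)] t w2 t1 1%N (fun=> 0%N).
rewrite tq; apply=> //.
- by rewrite E0 E1.
- rewrite E1 in E0.
  by have /= -> := @marker_distance w [::] (Start, t0) [::] (Mk t, t1) w2 ef E0 isT isT isT.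
- move=> v1 m v2 E2 pv1 mm; apply: funext => j; apply/esym.
  rewrite E1 E2 in E0.
  exact: (@configuration_copied w [::] (Start, t0) [::] (Mk t, t1) v1 m v2 j ef E0).
Qed.

End Words.

(** * From halting runs to error-free words *)

Definition op_regs o := match o with Inc r | Dec r | Zero r => [:: r] | _ => [::] end.

Definition program_regs (Pr : seq trans) := flatten [seq op_regs t.1.2 | t <- Pr].

Definition alphabet (Pr : seq trans) : seq letter :=
  [seq Mk t | t <- Pr] ++ Start ::
  flatten [seq [:: Keep r; New r; Del r] | r <- program_regs Pr].

Definition letter_reg a := match a with Keep j | New j | Del j => Some j | _ => None end.

Lemma mem_alphabet_reg Pr a j : letter_reg a = Some j ->
  (a \in alphabet Pr) = (j \in program_regs Pr).
Proof.
move=> aj; rewrite !(mem_cat, inE).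
have -> : (a \in [seq Mk t | t <- Pr]) = false.
  by apply/mapP => -[t _ E]; rewrite E in aj.
case: a aj => // i [->] /=; apply/flatten_mapP/idP => [[r rP]|jP];
  try (by rewrite !inE => /or3P[] /eqP // [->]);
  by exists j; rewrite // !inE eqxx ?orbT.
Qed.

Lemma mem_alphabet_Mk Pr t : (Mk t \in alphabet Pr) = (t \in Pr).
Proof.
rewrite mem_cat inE mem_map; last by move=> ? ? [].
apply/idP/idP => [|->//]; case/or3P => // /flatten_mapP[r _].
by rewrite !inE.
Qed.

Section Encoding.
Variables (R : realType) (Pr : seq trans) (e : nat).
Local Notation word := (seq (letter * R)).
Local Open Scope ring_scope.
Implicit Types (w u v c : word) (p : letter * R).

Definition config_of (f : letter -> option nat) v : word :=
  pmap (fun p => omap (fun j => (Keep j, p.2)) (f p.1)) v.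

Definition shift v : word := [seq (p.1, p.2 + 1) | p <- v].

Lemma mem_config_of f v a x :
  ((a, x) \in config_of f v) <-> exists j b, [/\ a = Keep j, f b = Some j & (b, x) \in v].
Proof.
rewrite mem_pmap; split.
  case/mapP => -[b y] bv /=; case E : (f b) => [j|] //= [-> ->].
  by exists j, b.
move=> [j [b [-> fb bv]]]; apply/mapP; exists (b, x) => //=.
by rewrite fb.
Qed.

Lemma mem_shift v a x : ((a, x) \in shift v) = ((a, x - 1) \in v).
Proof.
apply/mapP/idP => [[[b y] bv [-> ->]]|av]; first by rewrite addrK.
by exists (a, x - 1); rewrite //= subrK.
Qed.

Lemma cnt_config_of f v : cnt before (config_of f v) = cnt f v.
Proof.
apply: funext => j; elim: v => [//|[a x] v IH].
rewrite /cnt /config_of /= in IH *; case E : (f a) => [i|] //=.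
by rewrite IH.
Qed.

Lemma cnt_shift f v : cnt f (shift v) = cnt f v.
Proof. by apply: funext => j; rewrite /cnt count_map. Qed.

Lemma tsorted_config_of f v : tsorted v -> tsorted (config_of f v).
Proof.
rewrite /tsorted; elim: v => [//|[a x] v IH] /= /andP[av sv].
rewrite /config_of /=; case E : (f a) => [i|] /=; last exact: IH.
rewrite [X in _ && X]IH // andbT; apply/allP => -[b y] /mem_config_of[j [b' [_ _ /(allP av)]]].
by [].
Qed.

Lemma tsorted_shift v : tsorted v -> tsorted (shift v).
Proof.
rewrite /tsorted /shift pairwise_map; congr is_true.
by elim: v => //= p v ->; congr (_ && _); apply: eq_all => q /=; rewrite ltrD2r.
Qed.

Lemma tsorted_inj w a b x : tsorted w -> (a, x) \in w -> (b, x) \in w -> a = b.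
Proof.
move=> + aw; case/splitPr: aw => u v sw; have [su sv] := tsorted_mid sw.
rewrite mem_cat inE => /or3P[/su|/eqP[->]|/sv] //=; by rewrite ltxx.
Qed.

Record block (k : nat) v : Prop := Block {
  bl_sorted : tsorted v;
  bl_time : forall p, p \in v -> k%:R < p.2 < k.+1%:R;
  bl_plain : plain_word v }.

(** A correct suffix starting with the marker at time [k], whose first block finds the units [c].
    The alternative in [en_config] is a word that ends with this marker, as at [Halt], where no unit
    is copied any more. *)
Record encodes (k : nat) c w : Prop := Encodes {
  en_head : exists m v, w = (m, k%:R) :: v /\ marker m;
  en_sorted : tsorted w;
  en_follows : forall a b t, (a, t) \in w -> (b, t + 1) \in w -> follows a b;
  en_next : forall a b t t', (a, t) \in w -> (b, t') \in w -> needs_next a ->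
    t + 1 < t' -> exists b', (b', t + 1) \in w;
  en_markers : forall a b t t', (a, t) \in w -> (b, t') \in w ->
    marker a -> marker b -> t < t' -> t + 1 <= t';
  en_gap : forall a b t t', (a, t) \in w -> (b, t') \in w -> before b != None ->
    t < t' - 1 -> exists a', (a', t' - 1) \in w;
  en_in_config : forall b x, (b, x) \in w -> k%:R < x < k.+1%:R ->
    ~~ marker b /\ forall j, before b = Some j -> (Keep j, x) \in c;
  en_config : forall j x, (Keep j, x) \in c ->
    (exists b, before b = Some j /\ (b, x) \in w) \/ (forall p, p \in w -> p.2 <= k%:R) }.

Lemma encodes_ge k c w p : encodes k c w -> p \in w -> k%:R <= p.2.
Proof.
move=> en; have [m [v [E _]]] := en_head en; have := en_sorted en; rewrite E.
move=> /(tsorted_mid (u := [::]))[_ sv]; rewrite inE => /orP[/eqP->//|/sv /ltW].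
by [].
Qed.

(** Two events one time unit apart are the first two markers, an event of [v] and one of the first
    block of [w], or both in [w]. The middle case is where the configuration found by [w] has to be
    the one left by [v]. *)
Lemma encodes_cons k m v w : marker m -> block k v ->
  encodes k.+1 (shift (config_of after v)) w ->
  encodes k (config_of before v) ((m, k%:R) :: v ++ w).
Proof.
move=> mm bv en; have S1 : k.+1%:R = k%:R + 1 :> R by rewrite natr1.
have S2 : k.+2%:R = k%:R + 2 :> R by rewrite -addn2 natrD.
have wge p : p \in w -> k%:R + 1 <= p.2 by rewrite -S1; apply: encodes_ge en.
have vlt p : p \in v -> k%:R < p.2 < k%:R + 1 by move=> pv; rewrite -S1; exact: (bl_time bv pv).
have [m' [w' [Ew mm']]] := en_head en; rewrite S1 in Ew.
have hw : (m', k%:R + 1) \in w by rewrite Ew mem_head.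
have vpl a x : (a, x) \in v -> ~~ marker a by move/(allP (bl_plain bv)).
have inw a x : (a, x) \in (m, k%:R) :: v ++ w -> k%:R + 1 <= x -> (a, x) \in w.
  rewrite inE mem_cat => /or3P[/eqP[-> ->]|/vlt/=|//] ?; lra.
have casew a x : (a, x) \in (m, k%:R) :: v ++ w ->
    [\/ a = m /\ x = k%:R, (a, x) \in v | (a, x) \in w].
  by rewrite inE mem_cat => /or3P[/eqP[-> ->]|?|?]; [apply: Or31|apply: Or32|apply: Or33].
have inc a x j : (a, x) \in v -> after a = Some j ->
    (Keep j, x + 1) \in shift (config_of after v).
  by move=> av aj; rewrite mem_shift addrK; apply/mem_config_of; exists j, a.
have cin j x : (Keep j, x) \in shift (config_of after v) ->
    exists a, after a = Some j /\ (a, x - 1) \in v.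
  by rewrite mem_shift => /mem_config_of[i [a [[->] ai av]]]; exists a.
have wlt (y : R) : k%:R + 1 < y -> y < k%:R + 2 -> k.+1%:R < y < k.+2%:R.
  by rewrite S1 S2 => -> ->.
split.
- by exists m, (v ++ w).
- rewrite /tsorted /= pairwise_cat; apply/and4P; split.
  + apply/allP => p; rewrite mem_cat => /orP[/vlt|/wge] /=; lra.
  + by apply/allrelP => p q /vlt /= ? /wge ?; lra.
  + exact: bl_sorted bv.
  + exact: en_sorted en.
- move=> a b t /casew[[-> ->]|av|aw] bw.
  + have /inw/(_ (lexx _)) {}bw := bw.
    rewrite (tsorted_inj (en_sorted en) bw hw) /follows mm mm'.
    by case: (m) (m') mm mm' => [//|//|//||?] [].
  + have /= ta := vlt _ av; have {}bw : (b, t + 1) \in w by apply: inw bw _; lra.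
    have [|nb bc] := en_in_config en bw; first by apply: wlt; lra.
    rewrite /follows (negPf (vpl _ _ av)) (negPf nb) eqxx /=.
    case E : (after a) => [i|].
      case: (en_config en (inc _ _ _ av E)) => [[b' [bi bw']]|le].
        by rewrite (tsorted_inj (en_sorted en) bw bw') bi.
      by have := le _ bw; rewrite /= S1; lra.
    case Eb : (before b) => [j|] //; have [a' [aj]] := cin _ _ (bc _ Eb).
    by rewrite addrK => /(tsorted_inj (bl_sorted bv) av) Ea; rewrite -Ea E in aj.
  + have /= := wge _ aw => ?; apply: (en_follows en aw).
    by apply: inw bw _; lra.
- move=> a b t t' /casew[[-> ->]|av|aw] bw na tt'.
  + by exists m'; rewrite inE mem_cat hw !orbT.
  + have /= ta := vlt _ av; have {}bw : (b, t') \in w by apply: inw bw _; lra.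
    move: na; rewrite /needs_next (negPf (vpl _ _ av)) /=.
    case E : (after a) => [i|//] _.
    case: (en_config en (inc _ _ _ av E)) => [[b' [_ bw']]|le].
      by exists b'; rewrite inE mem_cat bw' !orbT.
    by have := le _ bw; rewrite /= S1; lra.
  + have /= ? := wge _ aw; have {}bw : (b, t') \in w by apply: inw bw _; lra.
    by have [b' bw'] := en_next en aw bw na tt'; exists b'; rewrite inE mem_cat bw' !orbT.
- move=> a b t t' /casew[[-> ->]|av|aw] bw ma mb tt'.
  + by case/casew: bw => [[_ tk]|/vpl|/wge//]; [lra|rewrite mb].
  + by have := vpl _ _ av; rewrite ma.
  + have /= ? := wge _ aw; have {}bw : (b, t') \in w by apply: inw bw _; lra.
    exact: (en_markers en aw bw ma mb tt').
- move=> a b t t' aw bw bb tt'.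
  have ta : k%:R <= t by case/casew: aw => [[_ ->]//|/vlt|/wge] /=; lra.
  have {}bw : (b, t') \in w by apply: inw bw _; lra.
  (* The event at [t' - 1] is in [v], or the first marker of [w], or provided by the same property
     of [w]. *)
  have [lt2|] := ltP t' (k%:R + 2).
    have [|_ bc] := en_in_config en bw; first by apply: wlt; lra.
    case E : (before b) bb => [j|//] _; have [a' [_ av]] := cin _ _ (bc _ E).
    by exists a'; rewrite inE mem_cat av !orbT.
  rewrite le_eqVlt => /predU1P[t'E|lt2].
    by exists m'; rewrite inE mem_cat -t'E (_ : _ - 1 = k%:R + 1) ?hw ?orbT //; lra.
  have [|a' aw'] := en_gap en hw bw bb; first by lra.
  by exists a'; rewrite inE mem_cat aw' !orbT.
- move=> b x + /andP[x1]; rewrite S1 => + x2.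
  case/casew => [[_ xk]|bv'|/wge/=]; [lra| |lra].
  split; first exact: vpl bv'.
  by move=> j bj; apply/mem_config_of; exists j, b.
- move=> j x /mem_config_of[i [b [[<-] bj bv']]]; left; exists b; split=> //.
  by rewrite inE mem_cat bv' !orbT.
Qed.

Definition keeps c := all (fun p => if p.1 is Keep _ then true else false) c.

Lemma keeps_config_of f v : keeps (config_of f v).
Proof.
rewrite /keeps /config_of; elim: v => [//|[a x] v IH] /=.
by case E : (f a) => [i|] //=; rewrite IH.
Qed.

Lemma keeps_shift c : keeps c -> keeps (shift c).
Proof. by rewrite /keeps all_map. Qed.

Lemma config_of_keeps f c : (forall j, f (Keep j) = Some j) -> keeps c -> config_of f c = c.
Proof.
move=> fK; rewrite /config_of; elim: c => [//|[a x] c IH] /=.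
by case: a => //= j kc; rewrite fK /= IH.
Qed.

Lemma config_of_cat f u v : config_of f (u ++ v) = config_of f u ++ config_of f v.
Proof. exact: pmap_cat. Qed.

Lemma keeps_plain c : keeps c -> plain_word c.
Proof. by apply: sub_all => -[[]]. Qed.

Lemma monitor_keeps b t c z : keeps c -> t.1.2 != Halt ->
  (forall j, t.1.2 = Zero j -> cnt before c j = 0%N) ->
  monitor (Some (Some (b, t))) ([seq p.1 | p <- c] ++ z) = monitor (Some (Some (b, t))) z.
Proof.
move=> + nh; elim: c => [//|[a x] c IH] /=; case: a => //= j kc zero.
rewrite (negPf nh) /=; case: eqP => [/zero|_]; first by rewrite /cnt /= eqxx.
apply: IH => // i /zero; rewrite /cnt /=; lia.
Qed.

Lemma cnt_cat f u v j : cnt f (u ++ v) j = (cnt f u j + cnt f v j)%N.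
Proof. exact: count_cat. Qed.

(* The new event is put before all others, where there is always room for it. *)
Lemma block_exists k c t s' : block k c -> keeps c -> eff t.1.2 (cnt before c) s' ->
  exists v, [/\ block k v, config_of before v = c, cnt after v = s',
    (forall z, monitor (Some (Some (false, t))) z ->
       monitor (enter t) ([seq p.1 | p <- v] ++ z)) &
    forall a x j, (a, x) \in v -> letter_reg a = Some j ->
      (Keep j, x) \in c \/ j \in op_regs t.1.2].
Proof.
move=> bc kc; have cK := config_of_keeps _ kc.
have cnt_after : cnt after c = cnt before c.
  by rewrite -[in RHS](cK after) // cnt_config_of.
have regc a x j : (a, x) \in c -> letter_reg a = Some j -> (Keep j, x) \in c.
  by move=> ac; have := allP kc _ ac; case: a ac => //= i ac _ [<-].
case Et : (t.1.2) => [r|r|r||] //=.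
(* Half-way between the marker and the first unit, or in the middle of the interval if there is no
   unit. *)
- move=> ->; pose x := if c is p :: _ then (k%:R + p.2) / 2 else k%:R + 1 / 2.
  have S1 : k.+1%:R = k%:R + 1 :> R by rewrite natr1.
  have xk : k%:R < x < k.+1%:R.
    rewrite /x S1; case: (c) bc => [_|p c' bc]; first lra.
    by have := bl_time bc (mem_head _ _); rewrite S1; lra.
  exists ((New r, x) :: c); split.
  + split; last by rewrite /plain_word /=; exact: keeps_plain.
      rewrite /tsorted /=; apply/andP; split; last exact: bl_sorted bc.
      rewrite /x; case: (c) bc => [//|p c' bc].
      have [kp _] := andP (bl_time bc (mem_head _ _)).
      have [_ pc] := tsorted_mid (u := [::]) (bl_sorted bc).
      by apply/allP => q; rewrite inE => /orP[/eqP->|/pc ?] /=; lra.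
    by move=> p; rewrite inE => /orP[/eqP->//|pc]; exact: (bl_time bc pc).
  + exact: cK.
  + have -> : cnt after ((New r, x) :: c) =
        (fun j => (r == j) + cnt after c j)%N.
      by apply: funext => j; rewrite /cnt /=; congr (nat_of_bool _ + _)%N; apply/eqP/eqP => [[]|->].
    by rewrite cnt_after; apply: funext => j; rewrite /upd eq_sym; case: eqP => [->|].
  + by move=> z mz; rewrite /enter Et /= Et eqxx /= monitor_keeps ?Et.
  + move=> a y j; rewrite inE => /orP[/eqP[-> _] [->]|ac aj].
      by right; rewrite inE.
    by left; apply: regc ac aj.
- move=> [r0 ->].
  have [x xc] : exists x, (Keep r, x) \in c.
    move: r0; rewrite -has_count => /hasP[[a x] ac /eqP /= ar]; exists x.
    by have := allP kc _ ac; case: a ac ar => //= i ac [<-].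
  case/splitPr: xc bc kc cK cnt_after regc {r0} => c1 c2 bc kc cK cnt_after regc.
  (* Sortedness depends on the times alone, so a [Keep r] can be relabelled [Del r] in place. *)
  have sE : forall a b : letter, tsorted (c1 ++ (a, x) :: c2) = tsorted (c1 ++ (b, x) :: c2).
    have tE w : tsorted w = pairwise <%R [seq p.2 | p <- w] by rewrite pairwise_map.
    by move=> a b; rewrite !tE !map_cat.
  have [k1 k2] : keeps c1 /\ keeps c2 by move: kc; rewrite /keeps all_cat => /andP[].
  exists (c1 ++ (Del r, x) :: c2); split.
  + split; first by rewrite (sE _ (Keep r)); exact: bl_sorted bc.
      move=> p; rewrite mem_cat inE => pc.
      case/or3P: pc => [pc|/eqP->|pc].
      * by apply: (bl_time bc); rewrite mem_cat pc.
      * by apply: (bl_time bc (p := (Keep r, x))); rewrite mem_cat mem_head orbT.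
      * by apply: (bl_time bc); rewrite mem_cat inE pc !orbT.
    by rewrite /plain_word all_cat /= [X in X && _]keeps_plain // [all _ c2]keeps_plain.
  + rewrite config_of_cat /config_of /= -!/(config_of _ _) !config_of_keeps //.
  + apply: funext => j; rewrite cnt_cat.
    have -> : cnt after ((Del r, x) :: c2) j = cnt after c2 j by [].
    rewrite /upd !cnt_cat -!(cnt_config_of after) !config_of_keeps //.
    rewrite /cnt /= eqxx -/(cnt _ _).
    case: eqP => [->|jr]; first by rewrite add1n addnS.
    by rewrite (_ : (Some r == Some j) = false) //; apply/eqP => -[] /esym.
  + move=> z mz; rewrite /enter Et /= map_cat -catA monitor_keeps ?Et //=.
    by rewrite Et eqxx /= monitor_keeps ?Et.
  + move=> a y j; rewrite mem_cat inE => /or3P[ac aj|/eqP[-> _] [->]|ac aj].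
    * by left; apply: (regc a) => //; rewrite mem_cat ac.
    * by right; rewrite inE.
    * by left; apply: (regc a) => //; rewrite mem_cat inE ac !orbT.
- move=> [r0 ->]; exists c; split=> //; first exact: cK.
    by move=> z mz; rewrite /enter Et /= monitor_keeps ?Et // => j [<-].
  by move=> a x j ac aj; left; apply: regc ac aj.
- move=> ->; exists c; split=> //; first exact: cK.
    by move=> z mz; rewrite /enter Et /= monitor_keeps ?Et.
  by move=> a x j ac aj; left; apply: regc ac aj.
Qed.

Lemma block_shift k v : block k v -> block k.+1 (shift (config_of after v)).
Proof.
move=> bv; split.
- exact/tsorted_shift/tsorted_config_of/bl_sorted/bv.
- move=> [a x]; rewrite mem_shift => /mem_config_of[j [b [_ _ /(bl_time bv)]]] /=.
  by rewrite -!natr1; lra.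
- exact/keeps_plain/keeps_shift/keeps_config_of.
Qed.

(** Induction on the run, for arbitrary times of the units in [c]: the block of the first step is
    built on [c], and the units that it leaves, shifted by one, are the configuration from which the
    rest is encoded. *)
Lemma run_encoding k q s k' q' s' h c : star (mstep Pr e) (k, q, s) (k', q', s') ->
  (q', Halt, h) \in Pr -> block k c -> keeps c -> cnt before c = s ->
  (forall j x, (Keep j, x) \in c -> j \in program_regs Pr) ->
  exists w, [/\ encodes k c w, {subset [seq p.1 | p <- w] <= alphabet Pr},
    exists t x v, [/\ w = (Mk t, x) :: v, t.1.1 = q & monitor (enter t) [seq p.1 | p <- v]] &
    forall x, ((Mk go, x) \in w -> e.+1%:R <= x) /\ ((Mk inp, x) \in w -> x < e.+1%:R)].
Proof.
move=> + hP; move Ex : (k, q, s) => X; move Ey : (k', q', s') => Y st.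
elim: st k q s Ex c Ey => {X Y} [X k q s EX c EY|X Y Z XY _ IH k q s EX c EZ].
  rewrite -EX in EY; case: EY => Ek Eq Es; subst k' q' s'; clear X EX => bc kc _ cP.
  exists [:: (Mk (q, Halt, h), k%:R)]; split.
  - split=> //.
    + by exists (Mk (q, Halt, h)), [::].
    + by move=> a b t; rewrite !inE => /eqP[_ ->] /eqP[_] ?; lra.
    + by move=> a b t t'; rewrite !inE => /eqP[_ ->] /eqP[_ ->] _ ?; lra.
    + by move=> a b t t'; rewrite !inE => /eqP[_ ->] /eqP[_ ->] _ _ ?; lra.
    + by move=> a b t t'; rewrite !inE => /eqP[_ ->] /eqP[-> _].
    + by move=> b x; rewrite !inE => /eqP[_ ->] ?; lra.
    + by move=> j x _; right => p; rewrite inE => /eqP->.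
  - by move=> a; rewrite inE => /eqP->; rewrite mem_alphabet_Mk.
  - by exists (q, Halt, h), k%:R, [::].
  - by move=> x; rewrite !inE; split=> /eqP.
case: Y XY IH => [[k1 q1] s1]; rewrite -{}EX => -[t [tP /= tq [-> ->] ts [tgo tinp]]].
move=> /(_ _ _ _ erefl) IH bc kc cs cP; rewrite -cs in ts.
have [v [bv vc av mv rv]] := block_exists bc kc ts.
have regP a x j : (a, x) \in v -> letter_reg a = Some j -> j \in program_regs Pr.
  move=> av' aj; case: (rv _ _ _ av' aj) => [/cP//|jt].
  by apply/flatten_mapP; exists t.
have [|||w [en wG [t' [x' [w' [Ew tq' mw]]]] wi]] := IH _ EZ (block_shift bv).
- exact/keeps_shift/keeps_config_of.
- by rewrite cnt_shift cnt_config_of.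
- move=> j x; rewrite mem_shift => /mem_config_of[i [a [[<-] aj av']]].
  by apply: (regP _ _ _ av'); case: (a) aj.
exists ((Mk t, k%:R) :: v ++ w); split.
- by rewrite -vc; apply: encodes_cons.
- move=> a; rewrite /= map_cat inE mem_cat => /or3P[/eqP->|/mapP[[b x] bv' ->]|/wG//].
    by rewrite mem_alphabet_Mk.
  have := allP (bl_plain bv) _ bv'; case E : (letter_reg b) => [j|]; last by case: b bv' E.
  by move=> _; rewrite (mem_alphabet_reg _ E); apply: regP bv' E.
- exists t, k%:R, (v ++ w); split=> //; rewrite map_cat; apply: mv.
  rewrite Ew /= tq' eqxx andbT.
  by case: (t.1.2) ts => //=.
- move=> x; have [wgo winp] := wi x.
  have nv b : marker b -> (b, x) \notin v.
    by move=> mb; apply/negP => /(allP (bl_plain bv)); rewrite mb.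
  rewrite !inE !mem_cat !(negPf (nv _ _)) //=; split=> /orP[/eqP[Et ->]|//].
    by rewrite ler_nat; apply: tgo.
  by rewrite ltr_nat ltnS; apply: tinp.
Qed.

Lemma halting_run_error_free : halting_run Pr e -> exists w,
  [/\ error_free e w, {subset [seq p.1 | p <- w] <= alphabet Pr} &
      forall p, p \in w -> 0 <= p.2].
Proof.
move=> [k [s [q [h [run hP]]]]].
have b1 : forall i, block i [::] by move=> i; split.
have [//|//|//|w [en wG [t [x [v [Ew tq mw]]]] wi]] := run_encoding run hP (b1 1%N).
(* The block of [Start] is empty, so the first transition stands at time 1 and finds all registers
   zero. *)
have := encodes_cons (m := Start) isT (b1 0%N) en; rewrite cat0s => en0.
exists ((Start, 0) :: w); split.
- split; try by case: en0.
    by rewrite Ew /= tq eqxx.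
  move=> t0 u [<- <-] y; rewrite add0r; exact: wi.
- move=> a; rewrite inE => /orP[/eqP->|/wG//].
  by rewrite mem_cat mem_head orbT.
- by move=> p pw; apply: encodes_ge en0 pw.
Qed.

End Encoding.

(** * Detecting errors with one clock *)

(* From [Ini], the automaton either enters the private location, where it
   accepts every timed word, or guesses an error: [Gap0] and [Gap1] look for a
   unit at time t + 1 without an event at time t, [Chk a] for an error one time
   unit after [a], [Inp] for an error in the length of the input phase, and
   [Mon] for a word rejected by the monitor. *)
Inductive loc :=
  Ini | Prv | Fin | Pre | Err | Inp | Gap0 | Gap1 | Chk of letter | Mon of mstate.

Definition code_loc l : nat + (letter + mstate) :=
  match l with
  | Ini => inl 0 | Prv => inl 1 | Fin => inl 2 | Pre => inl 3 | Err => inl 4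
  | Inp => inl 5 | Gap0 => inl 6 | Gap1 => inl 7
  | Chk a => inr (inl a) | Mon s => inr (inr s)
  end.

Definition decode_loc x :=
  match x with
  | inl 0 => Ini | inl 1 => Prv | inl 2 => Fin | inl 3 => Pre | inl 4 => Err
  | inl 5 => Inp | inl 6 => Gap0 | inl _ => Gap1
  | inr (inl a) => Chk a | inr (inr s) => Mon s
  end.

Lemma code_locK : cancel code_loc decode_loc.
Proof. by case. Qed.

HB.instance Definition _ := Countable.copy loc (can_type code_locK).

(* guard, whether the clock is reset, target *)
Definition arrow : Type := (seq (cmp * int) * bool * loc)%type.

(** In [Chk b] no arrow can be taken at clock value 1 on an event that follows [b], so an event read
    past 1 proves that nothing stands at 1. The silent arrow of [Gap0] resets the clock strictly
    after the last event, and [Gap1] reads events only at positive values: no event stands at the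
    guessed time. *)
Definition silent (l : loc) : seq arrow :=
  match l with
  | Ini => [:: ([::], false, Prv); ([::], false, Pre); ([::], false, Mon None)]
  | Prv | Err => [:: ([::], false, Fin)]
  | Gap0 => [:: ([:: (CGt, 0%R)], true, Gap1)]
  | Mon s => if accepting s then [::] else [:: ([::], false, Fin)]
  | _ => [::]
  end.

Definition arrows (e : nat) (l : loc) (a : letter) : seq arrow :=
  match l with
  | Ini => if a == Start then [:: ([::], true, Inp)] else [::]
  | Prv => [:: ([::], false, Prv)]
  | Err => [:: ([::], false, Err)]
  | Pre => [:: ([::], false, Pre); ([::], true, Gap0); ([::], true, Chk a)]
  | Inp =>
    (if a == Mk go then [:: ([:: (CLt, Posz e.+1)], false, Err)]
     else if a == Mk inp then [:: ([:: (CGe, Posz e.+1)], false, Err)] else [::])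
    ++ [:: ([::], false, Inp)]
  | Gap1 => ([:: (CGt, 0%R); (CLt, 1%R)], false, Gap1) ::
    if before a != None then [:: ([:: (CEq, 1%R)], false, Err)] else [::]
  | Chk b =>
    [:: ([:: (CEq, 0%R)], false, Err);
        ([:: (CLt, 1%R)], false, if marker b && marker a then Err else Chk b)]
    ++ (if follows b a then [::] else [:: ([:: (CEq, 1%R)], false, Err)])
    ++ (if needs_next b then [:: ([:: (CGt, 1%R)], false, Err)] else [::])
  | Mon s => [:: ([::], false, if delta s a is Some s' then Mon s' else Err)]
  | Fin | Gap0 => [::]
  end.

(** * The words accepted from each location *)

Section Acceptance.
Variables (R : realType) (G : seq letter) (e : nat).
Local Notation word := (seq (letter * R)).
Local Open Scope ring_scope.
Implicit Types (w u v : word) (p : letter * R) (r t x : R).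

Definition gsat (g : seq (cmp * int)) x := all (fun c => cmp_sem c.1 x c.2%:~R) g.

(* [accepts b l r t w]: at time [t] in location [l], the clock having last been
   reset at time [r], the word [w] can be accepted by a run that visits [Prv] if
   and only if [b]. *)
Inductive accepts : bool -> loc -> R -> R -> word -> Prop :=
| AcceptsFin r t : accepts false Fin r t [::]
| AcceptsSilent b l r t t' g rs l' w : t <= t' -> (g, rs, l') \in silent l ->
    gsat g (t' - r) -> accepts b l' (if rs then t' else r) t' w ->
    accepts ((l == Prv) || b) l r t w
| AcceptsLetter b l r t t' a g rs l' w : t <= t' -> a \in G ->
    (g, rs, l') \in arrows e l a -> gsat g (t' - r) ->
    accepts b l' (if rs then t' else r) t' w ->
    accepts ((l == Prv) || b) l r t ((a, t') :: w).

Definition timed t w := path <=%R t [seq p.2 | p <- w] && all (fun p => p.1 \in G) w.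

Lemma timed_cons t a x w : timed t ((a, x) :: w) = [&& t <= x, a \in G & timed x w].
Proof. by rewrite /timed /=; case: (t <= x); case: (a \in G); case: path. Qed.

Lemma timed_weaken t t' w : t <= t' -> timed t' w -> timed t w.
Proof.
case: w => [//|[a x] w] tt'; rewrite !timed_cons => /and3P[xt -> ->].
by rewrite (le_trans tt' xt).
Qed.

Lemma accepts_timed b l r t w : accepts b l r t w -> timed t w.
Proof.
elim=> // {b l r t w} [b l r t t' g rs l' w tt' _ _ _|b l r t t' a g rs l' w tt' aG _ _ _ tw].
  exact: timed_weaken.
by rewrite timed_cons tt' aG.
Qed.

Fixpoint bad_check b r w :=
  if w is (a, t) :: w' then
    [|| t == r, (t < r + 1) && (marker b && marker a || bad_check b r w'),
        (t == r + 1) && ~~ follows b a | (r + 1 < t) && needs_next b]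
  else false.

Fixpoint bad_gap r w :=
  if w is (a, t) :: w' then
    (r < t < r + 1) && bad_gap r w' || (t == r + 1) && (before a != None)
  else false.

Definition bad_input r w :=
  has (fun p => (p.1 == Mk go) && (p.2 < r + e.+1%:R) ||
                (p.1 == Mk inp) && (r + e.+1%:R <= p.2)) w.

Definition bad_infix w := exists u a x v, w = u ++ (a, x) :: v /\
  (bad_check a x v \/ exists2 y, x < y & bad_gap y v).

(** The language of each location in closed form, for runs that avoid [Prv]; hence [False] at [Prv].
    At [Gap0] the time of the silent reset is still to be guessed. *)
Definition bad l r t w : Prop :=
  match l with
  | Ini => [\/ bad_infix w, ~~ monitor None [seq p.1 | p <- w] |
               exists x v, w = (Start, x) :: v /\ bad_input x v]
  | Prv => False
  | Fin => w = [::]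
  | Pre => bad_infix w
  | Err => True
  | Inp => bad_input r w
  | Gap0 => exists y, [/\ r < y, t <= y & bad_gap y w]
  | Gap1 => bad_gap r w
  | Chk b => bad_check b r w
  | Mon s => ~~ monitor s [seq p.1 | p <- w]
  end.

Lemma accepts_bad l r t w : accepts false l r t w -> bad l r t w.
Proof.
move Eb : false => b acc; elim: acc Eb => {b l r t w}.
- by [].
- move=> b l r t t' g rs l' w tt' + sg _ IH /esym/negbT; rewrite negb_or.
  move=> + /andP[lP /negPf/esym/IH{}IH]; case: l lP => //=.
  + by move=> _; rewrite !inE => /or3P[] /eqP[? ? ?]; subst; [|apply: Or31|apply: Or32].
  + rewrite inE => _ /eqP[? ? ?]; subst.
    by exists t'; split=> //; move: sg; rewrite /= andbT subr_gt0.
  + move=> s _; case E : (accepting s) => //; rewrite inE => /eqP[? ? ?].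
    by subst; rewrite [w]IH /= E.
- move=> b l r t t' a g rs l' w tt' aG + + _ IH /esym/negbT; rewrite negb_or.
  move=> + + /andP[lP /negPf/esym/IH{}IH]; case: l lP => //=.
  + move=> _; case: eqP => // -> + _; rewrite inE => /eqP[? ? ?]; subst.
    by apply: Or33; exists t', w.
  + move=> _ + _; rewrite !inE => /or3P[] /eqP[? ? ?]; subst.
    * by have [u [c [x [v [-> H]]]]] := IH; exists ((a, t') :: u), c, x, v.
    * have [y [ty _ gy]] := IH; exists [::], a, t', w; split=> //.
      by right; exists y.
    * by exists [::], a, t', w; split=> //; left.
  + move=> _; rewrite mem_cat => /orP[|].
      case: ifP => [_|_].
        rewrite inE => /eqP[? ? ?]; subst; rewrite /= andbT ltrBlDl => lt1.
        by have -> : t' < r + e.+1%:R := lt1.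
      case: ifP => // _; rewrite inE => /eqP[? ? ?]; subst.
      rewrite /= andbT lerBrDl => le1.
      by have -> : r + e.+1%:R <= t' := le1.
    by rewrite inE => /eqP[? ? ?]; subst => _; rewrite [bad_input _ _]IH orbT.
  + move=> _; rewrite inE => /orP[/eqP[? ? ?]|]; first subst.
      rewrite /= andbT subr_gt0 ltrBlDl => /andP[-> ->].
      by rewrite [bad_gap r w]IH.
    case: ifP => // bn; rewrite inE => /eqP[? ? ?]; subst.
    by rewrite /= andbT subr_eq addrC => ->; rewrite orbT.
  + move=> c _; rewrite !(inE, mem_cat) => /or4P[/eqP[? ? ?]|/eqP[? ? ?]||]; try subst.
    * by rewrite /= andbT subr_eq add0r => ->.
    * rewrite /= andbT ltrBlDl => ->.
      by case: ifP IH => /= [_ _|_ ->]; rewrite !orbT.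
    * case: ifP => // nf; rewrite inE => /eqP[? ? ?]; subst.
      by rewrite /= andbT subr_eq addrC => ->; rewrite !orbT.
    * case: ifP => // nf; rewrite inE => /eqP[? ? ?]; subst.
      by rewrite /= andbT ltrBrDl => ->; rewrite !orbT.
  + move=> s _; rewrite inE => /eqP[? ? ?] _; subst.
    by case: (delta s a) IH.
Qed.

Lemma accepts_loop l r t w :
  (forall a, ([::], false, l) \in arrows e l a) -> ([::], false, Fin) \in silent l ->
  timed t w -> accepts (l == Prv) l r t w.
Proof.
move=> lP lF; elim: w t => [|[a x] w IH] t; first move=> _.
  rewrite -[_ == _]orbF; apply: (AcceptsSilent (lexx t) lF) => //.
  exact: AcceptsFin.
rewrite timed_cons => /and3P[tx aG tw].
rewrite -[l == Prv]orbb.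
exact: (AcceptsLetter (rs := false) tx aG (lP a) isT (IH _ tw)).
Qed.

Lemma accepts_err r t w : timed t w -> accepts false Err r t w.
Proof. exact: (@accepts_loop Err). Qed.

Lemma accepts_prv r t w : timed t w -> accepts true Prv r t w.
Proof. exact: (@accepts_loop Prv). Qed.

Lemma accepts_check b r t w : timed t w -> bad_check b r w -> accepts false (Chk b) r t w.
Proof.
elim: w t => [//|[a x] w IH] t; rewrite timed_cons => /and3P[tx aG tw] /=.
have AL g l' : (g, false, l') \in arrows e (Chk b) a -> gsat g (x - r) ->
    accepts false l' r x w -> accepts false (Chk b) r t ((a, x) :: w).
  exact: (@AcceptsLetter false (Chk b) r t x a g false l' w tx aG).
case/or4P => [xr|/andP[xr H]|/andP[xr nf]|/andP[xr nn]].
- apply: (AL [:: (CEq, 0)] Err); last exact: accepts_err.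
    by rewrite !inE.
  by rewrite /= andbT subr_eq add0r.
- apply: (AL [:: (CLt, 1)] (if marker b && marker a then Err else Chk b)).
  + by rewrite !inE eqxx orbT.
  + by rewrite /= andbT ltrBlDl.
  + by case: ifP H => /= [_ _|_ H]; [exact: accepts_err|exact: IH].
- apply: (AL [:: (CEq, 1)] Err); last exact: accepts_err.
    by rewrite !(inE, mem_cat) (negPf nf) inE eqxx !orbT.
  by rewrite /= andbT subr_eq addrC.
- apply: (AL [:: (CGt, 1)] Err); last exact: accepts_err.
    by rewrite !(inE, mem_cat) nn inE eqxx !orbT.
  by rewrite /= andbT ltrBrDl.
Qed.

Lemma accepts_gap r t w : timed t w -> bad_gap r w -> accepts false Gap1 r t w.
Proof.
elim: w t => [//|[a x] w IH] t; rewrite timed_cons => /and3P[tx aG tw] /=.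
have AL g l' : (g, false, l') \in arrows e Gap1 a -> gsat g (x - r) ->
    accepts false l' r x w -> accepts false Gap1 r t ((a, x) :: w).
  exact: (@AcceptsLetter false Gap1 r t x a g false l' w tx aG).
case/orP => [/andP[/andP[rx xr] H]|/andP[xr bn]].
- apply: (AL [:: (CGt, 0); (CLt, 1)] Gap1); last exact: IH.
    by rewrite inE eqxx.
  by rewrite /= andbT subr_gt0 ltrBlDl rx.
- apply: (AL [:: (CEq, 1)] Err); last exact: accepts_err.
    by rewrite inE bn inE eqxx !orbT.
  by rewrite /= andbT subr_eq addrC.
Qed.

Lemma accepts_input r t w : timed t w -> bad_input r w -> accepts false Inp r t w.
Proof.
elim: w t => [//|[a x] w IH] t; rewrite timed_cons => /and3P[tx aG tw] /=.
have AL g l' : (g, false, l') \in arrows e Inp a -> gsat g (x - r) ->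
    accepts false l' r x w -> accepts false Inp r t ((a, x) :: w).
  exact: (@AcceptsLetter false Inp r t x a g false l' w tx aG).
case/orP => [/orP[]/andP[/eqP/= aE xr]|H].
- apply: (AL [:: (CLt, Posz e.+1)] Err); last exact: accepts_err.
    by rewrite mem_cat aE eqxx inE eqxx.
  by rewrite /= andbT ltrBlDl.
- apply: (AL [:: (CGe, Posz e.+1)] Err); last exact: accepts_err.
    by rewrite mem_cat aE /= inE eqxx.
  by rewrite /= andbT lerBrDl.
- apply: (AL [::] Inp) => //; last exact: IH.
  by rewrite mem_cat inE eqxx orbT.
Qed.

Lemma accepts_monitor s r t w : timed t w -> ~~ monitor s [seq p.1 | p <- w] ->
  accepts false (Mon s) r t w.
Proof.
elim: w s t => [|[a x] w IH] s t /=.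
  move=> _ ns; apply: (@AcceptsSilent false (Mon s) r t t [::] false Fin) => //.
    by rewrite /= (negPf ns) inE.
  exact: AcceptsFin.
rewrite timed_cons => /and3P[tx aG tw] H.
apply: (@AcceptsLetter false (Mon s) r t x a [::] false
  (if delta s a is Some s' then Mon s' else Err)) => //.
  by rewrite inE.
by case: (delta s a) H => [s' /IH|_]; [apply|exact: accepts_err].
Qed.

Lemma accepts_infix r t w : timed t w -> bad_infix w -> accepts false Pre r t w.
Proof.
move=> tw [u [a [x [v [E H]]]]]; elim: u w r t tw E => [|[c y] u IH] w r t tw E.
  move: tw; rewrite E timed_cons => /and3P[tx aG tv].
  case: H => [H|[y xy H]].
    apply: (@AcceptsLetter false Pre r t x a [::] true (Chk a)) => //.
      by rewrite !inE eqxx !orbT.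
    exact: accepts_check.
  apply: (@AcceptsLetter false Pre r t x a [::] true Gap0) => //.
  apply: (@AcceptsSilent false Gap0 x x y [:: (CGt, 0)] true Gap1); first exact: ltW.
  - by rewrite inE.
  - by rewrite /= andbT subr_gt0.
  - apply: accepts_gap => //.
    (* The rest can be read after the silent move at time [y], because [bad_gap] puts its first
       event later than [y]. *)
    case: (v) tv H => [//|[b z] v']; rewrite !timed_cons => /and3P[_ -> ->] /=.
    by case/orP => /andP[]; [case/andP => /ltW-> | move/eqP-> => _; rewrite lerDl ler01].
move: tw; rewrite E timed_cons => /and3P[tx aG tv].
apply: (@AcceptsLetter false Pre r t y c [::] false Pre) => //.
exact: IH.
Qed.

Lemma accepts_public w : timed 0 w -> accepts false Ini 0 0 w <-> bad Ini 0 0 w.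
Proof.
move=> tw; split; first exact: accepts_bad.
have AS l' : ([::], false, l') \in silent Ini -> accepts false l' 0 0 w ->
    accepts false Ini 0 0 w.
  by move=> lI; apply: (@AcceptsSilent false Ini 0 0 0 [::] false l').
case=> [H|H|[x [v [E H]]]].
- by apply: (AS Pre) => //; apply: accepts_infix.
- by apply: (AS (Mon None)) => //; apply: accepts_monitor.
- move: tw; rewrite E timed_cons => /and3P[tx aG tv].
  by apply: (@AcceptsLetter false Ini 0 0 x Start [::] true Inp) => //; apply: accepts_input.
Qed.

Lemma accepts_private w : accepts true Ini 0 0 w <-> timed 0 w.
Proof.
split=> [/accepts_timed//|tw].
by apply: (@AcceptsSilent true Ini 0 0 0 [::] false Prv) => //; apply: accepts_prv.
Qed.

End Acceptance.

(** * The publicly accepted words are those that are not error-free *)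

Section Errors.
Variables (R : realType) (G : seq letter) (e : nat).
Local Notation word := (seq (letter * R)).
Local Open Scope ring_scope.
Implicit Types (w u v : word) (p : letter * R) (r t x : R).

Lemma tsorted_cons p w : tsorted (p :: w) = all (fun q => p.2 < q.2) w && tsorted w.
Proof. by []. Qed.

(** The scan stops at the first event at or past [r + 1]. In a strictly increasing word no later
    event is at or before that time, so the scan amounts to three existence statements. *)
Lemma bad_checkE b r v : tsorted ((b, r) :: v) -> bad_check b r v =
  [|| has (fun p => (p.2 < r + 1) && (marker b && marker p.1)) v,
      has (fun p => (p.2 == r + 1) && ~~ follows b p.1) v |
      [&& needs_next b, has (fun p => r + 1 < p.2) v & ~~ has (fun p => p.2 == r + 1) v]].
Proof.
elim: v => [|[a t] v IH]; first by rewrite /= andbF.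
rewrite !tsorted_cons => /and3P[/= /andP[rt rv] tv sv].
have -> : (t == r) = false by rewrite gt_eqF.
have later x (f : pred (letter * R)) : x <= t -> (forall q, f q -> q.2 <= x) -> has f v = false.
  move=> xt fx; apply/hasPn => q qv; apply/negP => /fx qx.
  by have := lt_le_trans (allP tv _ qv) (le_trans qx xt); rewrite ltxx.
case: (ltgtP t (r + 1)) => [lt1|gt1|eq1] /=.
- by rewrite IH ?tsorted_cons /= ?rv // -!orbA orbF.
- rewrite (later (r + 1)) => [||q /andP[/ltW]//]; last exact: ltW.
  rewrite (later (r + 1)) => [||q /andP[/eqP->]//]; last exact: ltW.
  rewrite (later (r + 1)) => [||q /eqP->//]; last exact: ltW.
  by rewrite andbT.
- rewrite (later (r + 1)) => [||q /andP[/ltW]//]; last by rewrite eq1.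
  rewrite (later (r + 1)) => [||q /andP[/eqP->]//]; last by rewrite eq1.
  by rewrite !andbF !orbF.
Qed.

Lemma bad_gapP r v : tsorted v ->
  bad_gap r v <-> (forall p, p \in v -> r < p.2) /\ (exists b, before b != None /\ (b, r + 1) \in v).
Proof.
elim: v => [_|[a t] v IH]; first by split=> // -[_ [b []]].
rewrite tsorted_cons => /andP[/= tv sv]; split.
  case/orP => [/andP[/andP[rt tr] /(IH sv)[rv [b [bb bv]]]]|/andP[/eqP tr ab]].
    split=> [p|]; first by rewrite inE => /orP[/eqP->//|/rv].
    by exists b; rewrite inE bv orbT.
  split=> [p|]; last by exists a; rewrite inE tr eqxx.
  have rt : r < t by rewrite tr ltrDl ltr01.
  by rewrite inE => /orP[/eqP->//|/(allP tv)]; apply: lt_trans.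
case=> rv [b [bb]]; rewrite inE => /orP[/eqP[<- <-]|bv]; first by rewrite eqxx bb orbT.
rewrite (rv (a, t)) ?mem_head //= (allP tv _ bv) /=; apply/orP; left.
apply/(IH sv); split; last by exists b.
by move=> p pv; apply: rv; rewrite inE pv orbT.
Qed.

(** [(b, x)] is the event on which the automaton enters [Gap0]: the guessed time [y] lies after it
    and before all that follows. *)
Lemma last_before w y a t : tsorted w -> (a, t) \in w -> t < y ->
  (forall p, p \in w -> p.2 != y) ->
  exists u b x v, [/\ w = u ++ (b, x) :: v, x < y & forall p, p \in v -> y < p.2].
Proof.
elim: w a t => [//|[c z] w IH] a t; rewrite tsorted_cons => /andP[/= zw sw] aw ty ny.
have [/hasP[[d x] dw xy]|nw] := boolP (has (fun p => p.2 < y) w).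
  have [|u [b [x' [v [-> x'y vy]]]]] := IH d x sw dw xy.
    by move=> p pw; apply: ny; rewrite inE pw orbT.
  by exists ((c, z) :: u), b, x', v.
exists [::], c, z, w; split=> //.
  move: aw; rewrite inE => /orP[/eqP[_ <-//]|aw].
  by have := hasPn nw _ aw; rewrite ty.
move=> p pw; have := hasPn nw _ pw; rewrite -leNgt le_eqVlt eq_sym => /orP[] //.
by rewrite (negPf (ny _ _)) // inE pw orbT.
Qed.

Lemma timed_split t u a x v : timed G t (u ++ (a, x) :: v) -> timed G x v.
Proof.
elim: u t => [|[b y] u IH] t; first by rewrite timed_cons => /and3P[].
by rewrite cat_cons timed_cons => /and3P[_ _ /IH].
Qed.

(** Timed words may repeat a timestamp, but two consecutive events at the same time are an error
    found by [bad_check] at clock value 0. *)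
Lemma timed_tsorted w : timed G 0 w -> ~ bad_infix w -> tsorted w.
Proof.
move=> tw nb; suff : forall u v, w = u ++ v -> tsorted v by move/(_ [::]); apply.
move=> u v; elim: v u => [//|[a x] v IH] u E; rewrite tsorted_cons.
have sv : tsorted v by apply: (IH (rcons u (a, x))); rewrite cat_rcons.
rewrite sv andbT; case: v E sv {IH} => [//|[b y] v] E; rewrite tsorted_cons => /andP[yv _].
have xy : x < y.
  have := tw; rewrite E => /timed_split; rewrite timed_cons => /and3P[+ _ _].
  rewrite le_eqVlt => /predU1P[xy|//]; case: nb.
  by exists u, a, x, ((b, y) :: v); split=> //; left; rewrite /= xy eqxx.
apply/allP => p; rewrite inE => /orP[/eqP->//|/(allP yv)].
exact: lt_trans.
Qed.

Lemma bad_error_free w : timed G 0 w -> ~ bad e Ini 0 0 w -> error_free e w.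
Proof.
move=> tw nb; have nbi : ~ bad_infix w by move=> H; apply: nb; apply: Or31.
have sw := timed_tsorted tw nbi.
(* The rest of the word after each event passes [bad_check]; the fields on copies, missing copies
   and markers are read off this. *)
have chk a t : (a, t) \in w -> exists2 v,
    (forall p, p \in w -> t < p.2 -> p \in v) &
    tsorted ((a, t) :: v) /\ ~~ bad_check a t v /\ {subset v <= w}.
  move=> aw; case/splitPr: aw sw nbi {tw nb} => u v sw nbi.
  exists v; last split.
  - move=> p; have [su _] := tsorted_mid sw.
    by rewrite mem_cat inE => /or3P[/su/lt_trans H|/eqP->|//] => [/H|]; rewrite ltxx.
  - by move: sw; rewrite /tsorted pairwise_cat => /and3P[].
  - split; last by move=> p pv; rewrite mem_cat inE pv !orbT.
    by apply/negP => H; apply: nbi; exists u, a, t, v; split=> //; left.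
split=> //.
- by apply/negPn/negP => H; apply: nb; apply: Or32.
- move=> a b t aw bw; have [v vP [sv [nc _]]] := chk _ _ aw.
  have bv := vP _ bw; rewrite /= ltrDl ltr01 in bv; have {}bv := bv isT.
  apply/negPn/negP => nf; move: nc; rewrite bad_checkE //.
  case/negP; apply/or3P; apply: Or32; apply/hasP.
  by exists (b, t + 1); rewrite //= eqxx.
- move=> a b t t' aw bw na lt1; have [v vP [sv [nc vw]]] := chk _ _ aw.
  have bv : (b, t') \in v by apply: vP => //=; apply: lt_trans lt1; rewrite ltrDl ltr01.
  have [/hasP[[b' x] b'v /eqP/= Ex]|nh] := boolP (has (fun p => p.2 == t + 1) v).
    by exists b'; rewrite -Ex; apply: vw.
  move: nc; rewrite bad_checkE // na nh andbT; case/negP.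
  by apply/or3P; apply: Or33; apply/hasP; exists (b, t').
- move=> a b t t' aw bw ma mb lt1; have [v vP [sv [nc vw]]] := chk _ _ aw.
  have bv := vP _ bw lt1; rewrite leNgt; apply/negP => lt2.
  move: nc; rewrite bad_checkE //; case/negP.
  by apply/or3P; apply: Or31; apply/hasP; exists (b, t'); rewrite //= lt2 ma mb.
- move=> a b t t' aw bw bb lt1.
  have [/hasP[[a' x] a'w /eqP/= Ex]|nh] := boolP (has (fun p => p.2 == t' - 1) w).
    by exists a'; rewrite -Ex.
  have [|u [c [x [v [E xy vy]]]]] := last_before sw aw lt1.
    by move=> p pw; have := hasPn nh _ pw.
  exfalso; apply: nbi; exists u, c, x, v; split=> //; right; exists (t' - 1) => //.
  have sv : tsorted v.
    by move: sw; rewrite E /tsorted pairwise_cat => /and3P[_ _ /andP[]].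
  apply/(bad_gapP _ sv); split=> //; exists b; rewrite subrK; split=> //.
  move: bw; rewrite E mem_cat inE; have := sw; rewrite E => /tsorted_mid[su _].
  by case/or3P => [/su/= H|/eqP[_ H]|//]; exfalso; lra.
- move=> t0 v E t; have nI : ~~ bad_input e t0 v.
    by apply/negP => H; apply: nb; apply: Or33; exists t0, v.
  split=> tv; have := hasPn nI _ tv; rewrite /= ?orbF; first by rewrite -leNgt.
  by rewrite -ltNge.
Qed.

Lemma error_free_bad w : error_free e w -> ~ bad e Ini 0 0 w.
Proof.
move=> ef; have sw := ef_sorted ef; case.
- move=> [u [a [x [v [E]]]]].
  have aw : (a, x) \in w by rewrite E mem_cat mem_head orbT.
  have vw p : p \in v -> p \in w by rewrite E mem_cat inE => ->; rewrite !orbT.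
  have := sw; rewrite E => /tsorted_mid[/= ux xv].
  have sv : tsorted ((a, x) :: v) by move: sw; rewrite E /tsorted pairwise_cat => /and3P[].
  case=> [|[y xy]].
    rewrite bad_checkE // => /or3P[/hasP[[b t] bv]|/hasP[[b t] bv]|].
    + move=> /= /and3P[t1 ma mb]; have /= xt := xv _ bv.
      by have := ef_markers ef aw (vw _ bv) ma mb xt; rewrite leNgt t1.
    + move=> /= /andP[/eqP t1]; rewrite t1 in bv.
      by rewrite (ef_follows ef aw (vw _ bv)).
    + case/and3P => na /hasP[[b t] bv /= lt1] nh.
      have [b' b'w] := ef_next ef aw (vw _ bv) na lt1.
      move: b'w; rewrite E mem_cat inE => /or3P[/ux/=|/eqP[_]|b'v].
      * by rewrite ltNge lerDl ler01.
      * by move/eqP; rewrite -subr_eq0 addrAC subrr add0r oner_eq0.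
      * by have := hasPn nh _ b'v; rewrite eqxx.
  have {}sv : tsorted v by move: sv; rewrite tsorted_cons => /andP[].
  move/(bad_gapP _ sv) => [yv [b [bb bv]]].
  have [|a'] := ef_gap ef aw (vw _ bv) bb; first by rewrite addrK.
  rewrite addrK E mem_cat inE => /or3P[/ux/= yx|/eqP[_ yx]|/yv/=].
  + by have := lt_trans xy yx; rewrite ltxx.
  + by rewrite yx ltxx in xy.
  + by rewrite ltxx.
- by rewrite (ef_monitor ef).
- move=> [x [v [E /hasP[[b t] bv /= H]]]]; have [h1 h2] := ef_input ef E t.
  case/orP: H => /andP[/eqP bE]; rewrite bE in bv.
    by rewrite ltNge h1.
  by rewrite leNgt h2.
Qed.

End Errors.

Section Universality.
Variables (R : realType) (Pr : seq trans) (e : nat).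

Lemma universal_iff_no_halting_run :
  (forall w : seq (letter * R), accepts (alphabet Pr) e true Ini 0%R 0%R w ->
     accepts (alphabet Pr) e false Ini 0%R 0%R w) <-> ~ halting_run Pr e.
Proof.
split=> [H /(halting_run_error_free R)[w [ef wG wpos]]|H w].
  have tw : timed (alphabet Pr) 0%R w.
    apply/andP; split; last first.
      by apply/allP => p pw; apply: wG; apply/mapP; exists p.
    have : sorted <%R [seq p.2 | p <- w].
      by apply: pairwise_sorted; rewrite pairwise_map; exact: (ef_sorted ef).
    case: (w) wpos => [//|p w' pos] /=; rewrite pos ?mem_head //=.
    exact: (sub_path (@ltW _ R)).
  have /H/accepts_bad := (accepts_private (alphabet Pr) e w).2 tw.
  exact: error_free_bad ef.
move/accepts_private => tw; apply/(accepts_public _ tw); apply: contrapT => nb.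
apply: H; apply: (error_free_halting_run (w := w)); last exact: (bad_error_free tw nb).
move=> t x tx; rewrite -mem_alphabet_Mk.
by have /andP[_ /allP/(_ _ tx)] := tw.
Qed.

End Universality.

(** * The timed automaton *)

Definition mstates (Pr : seq trans) : seq mstate :=
  [:: None; Some None] ++ [seq Some (Some (b, t)) | b <- [:: true; false], t <- Pr].

(** [Inp] comes first, as do the markers in [alphabet], so that the edges mentioning [e] are among
    the first three when [go] and [inp] head [Pr]. [Fin] is left out, having no outgoing arrow. *)
Definition locations (Pr : seq trans) : seq loc :=
  [:: Inp; Ini; Prv; Pre; Err; Gap0; Gap1] ++
  [seq Chk a | a <- alphabet Pr] ++ [seq Mon s | s <- mstates Pr].

Definition raw_edge : Type := (loc * option letter * arrow)%type.

Definition raw_edges_from Pr e l : seq raw_edge :=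
  [seq (l, None, o) | o <- silent l] ++
  flatten [seq [seq (l, Some a, o) | o <- arrows e l a] | a <- alphabet Pr].

Definition raw_edges Pr e := flatten [seq raw_edges_from Pr e l | l <- locations Pr].

Lemma mem_raw_edges Pr e l a o : ((l, a, o) \in raw_edges Pr e) =
  (l \in locations Pr) &&
  (if a is Some b then (b \in alphabet Pr) && (o \in arrows e l b) else o \in silent l).
Proof.
apply/flatten_mapP/andP => [[l' l'P]|[lP H]].
  rewrite mem_cat => /orP[/mapP[o' oP [-> -> ->]]//|].
  by case/flatten_mapP => b bP /mapP[o' oP [-> -> ->]]; rewrite bP.
exists l => //; rewrite mem_cat; case: a H => [b /andP[bP oP]|oP]; apply/orP.
  by right; apply/flatten_mapP; exists b => //; apply: map_f.
by left; apply: map_f.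
Qed.

Lemma mem_mstates Pr b t : (Some (Some (b, t)) \in mstates Pr) = (t \in Pr).
Proof.
rewrite mem_cat; apply/orP/idP => [[|/allpairsP[[b' t'] [_ tP [_ ->]]]]//|tP].
by right; apply/allpairsP; exists (b, t); split=> //; case: b.
Qed.

Lemma delta_mstates Pr s a s' : s \in mstates Pr -> a \in alphabet Pr ->
  delta s a = Some s' -> s' \in mstates Pr.
Proof.
case: s => [[[b t]|]|] sP; case: a => [j|j|j||t'] aP //=.
- by case: ifP => // _ [<-].
- by case: ifP => // _ [<-]; rewrite mem_mstates -(mem_mstates _ b).
- by case: ifP => // _ [<-]; rewrite mem_mstates -(mem_mstates _ b).
- by case: ifP => // _ [<-]; rewrite mem_mstates -mem_alphabet_Mk.
- by case: ifP => // _ [<-]; rewrite mem_mstates -mem_alphabet_Mk.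
- by case=> <-.
Qed.

Lemma mem_locations_Chk Pr a : a \in alphabet Pr -> Chk a \in locations Pr.
Proof. by move=> aP; rewrite !mem_cat (map_f Chk aP) orbT. Qed.

Lemma mem_locations_Mon Pr s : (Mon s \in locations Pr) = (s \in mstates Pr).
Proof.
rewrite 2!mem_cat [X in _ || (_ || X)]mem_map; last by move=> ? ? [].
apply/idP/idP => [|->]; last by rewrite !orbT.
by case/or3P => // /mapP[].
Qed.

Lemma mem_locations_basic Pr l : l \in [:: Inp; Ini; Prv; Pre; Err; Gap0; Gap1] ->
  l \in locations Pr.
Proof. by move=> lP; rewrite mem_cat lP. Qed.

(** The finite list of locations is closed under arrows, so runs stay where [loc_ord] is
    injective. *)
Lemma raw_edges_target Pr e l a o : (l, a, o) \in raw_edges Pr e ->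
  o.2 \in Fin :: locations Pr.
Proof.
rewrite mem_raw_edges => /andP[lP H]; rewrite inE.
have basic l' : l' \in [:: Inp; Ini; Prv; Pre; Err; Gap0; Gap1] -> l' \in locations Pr.
  exact: mem_locations_basic.
have chk := @mem_locations_Chk Pr; have mon := mem_locations_Mon Pr.
move: (locations Pr) basic chk mon lP => Ls basic chk mon lP.
case: o H => [[g rs] l2] /=; case: a => [a /andP[aP]|].
- case: l lP => [||||||||b|s] lP /=.
  + by case: ifP => // _; rewrite inE => /eqP[_ _ ->]; rewrite basic ?orbT.
  + by rewrite inE => /eqP[_ _ ->]; rewrite basic ?orbT.
  + by [].
  + rewrite !inE => /or3P[] /eqP[_ _ ->]; rewrite ?(basic Pre) ?(basic Gap0) ?orbT //.
    by rewrite chk ?orbT.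
  + by rewrite inE => /eqP[_ _ ->]; rewrite basic ?orbT.
  + rewrite mem_cat inE => /orP[|/eqP[_ _ ->]]; last by rewrite basic ?orbT.
    by do 2?case: ifP => // _; rewrite inE => /eqP[_ _ ->]; rewrite basic ?orbT.
  + by [].
  + rewrite inE => /orP[/eqP[_ _ ->]|]; first by rewrite basic ?orbT.
    by case: ifP => // _; rewrite inE => /eqP[_ _ ->]; rewrite basic ?orbT.
  + rewrite !(inE, mem_cat) => /or4P[/eqP[_ _ ->]|/eqP[_ _ ->]||].
    * by rewrite basic ?orbT.
    * by case: ifP => _; [rewrite basic ?orbT | rewrite lP orbT].
    * by case: ifP => // _; rewrite inE => /eqP[_ _ ->]; rewrite basic ?orbT.
    * by case: ifP => // _; rewrite inE => /eqP[_ _ ->]; rewrite basic ?orbT.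
  + rewrite inE => /eqP[_ _ ->]; rewrite mon in lP.
    case E : (delta s a) => [s'|]; last by rewrite basic ?orbT.
    by rewrite mon (delta_mstates lP aP E) orbT.
- case: l lP => [||||||||b|s] lP //=.
  + rewrite !inE => /or3P[] /eqP[_ _ ->]; rewrite ?(basic Pre) ?(basic Prv) ?orbT //.
    by rewrite mon orbT.
  + by rewrite inE => /eqP[_ _ ->].
  + by rewrite inE => /eqP[_ _ ->].
  + by rewrite inE => /eqP[_ _ ->]; rewrite basic ?orbT.
  + by case: ifP => // _; rewrite inE => /eqP[_ _ ->].
Qed.

(* Locked, as computing these numbers in unary is hopeless. *)
Definition loc_code (l : loc) : nat := locked pickle l.
Definition letter_code (a : letter) : nat := locked pickle a.

Lemma loc_code_inj : injective loc_code.
Proof. by rewrite /loc_code -lock; apply: (pcan_inj pickleK). Qed.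

Lemma letter_code_inj : injective letter_code.
Proof. by rewrite /letter_code -lock; apply: (pcan_inj pickleK). Qed.

(** * The traces of the automaton and its opacity *)

Section Automaton.
Variables (N : nat) (Pr : seq trans) (e : nat).

(** An index is the code of the location itself, so that codes of edges do not depend on [N]; the
    bounds assumed below keep [inord] from taking its default value. *)
Definition loc_ord (l : loc) : 'I_N.+1 := inord (loc_code l).
Definition letter_ord (a : letter) : 'I_N.+1 := inord (letter_code a).

Definition edge_of (x : raw_edge) : edge 'I_N.+1 'I_N.+1 'I_1 :=
  let: (l, a, (g, rs, l')) := x in
  Edge (loc_ord l) [seq (ord0, c.1, c.2) | c <- g] (omap letter_ord a)
    (if rs then setT else set0) (loc_ord l').

Definition automaton : ta 'I_N.+1 'I_N.+1 'I_1 :=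
  TA (loc_ord Ini) [set loc_ord Prv] [set loc_ord Fin] [ffun=> [::]]
    [seq edge_of x | x <- raw_edges Pr e].

Hypothesis loc_bound : forall l, l \in Fin :: locations Pr -> loc_code l <= N.
Hypothesis letter_bound : forall a, a \in alphabet Pr -> letter_code a <= N.

Lemma loc_ord_inj : {in Fin :: locations Pr &, injective loc_ord}.
Proof.
move=> l l' lP lP' /(congr1 (@nat_of_ord _)); rewrite /loc_ord !inordK ?ltnS ?loc_bound //.
exact: loc_code_inj.
Qed.

Lemma letter_ord_inj : {in alphabet Pr &, injective letter_ord}.
Proof.
move=> a a' aP aP' /(congr1 (@nat_of_ord _)); rewrite /letter_ord !inordK ?ltnS ?letter_bound //.
exact: letter_code_inj.
Qed.

Variable R : realType.
Local Open Scope ring_scope.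
Local Notation word := (seq (letter * R)).

Definition word_ord (w : word) : seq ('I_N.+1 * R) := [seq (letter_ord p.1, p.2) | p <- w].

Lemma sat_edge_of (mu : valuation R 'I_1) (g : seq (cmp * int)) :
  sat mu [seq (ord0, c.1, c.2) | c <- g] = gsat g (mu ord0).
Proof. by rewrite /sat /gsat all_map. Qed.

Lemma sat_inv (l : 'I_N.+1) (mu : valuation R 'I_1) : sat mu (Defs.inv automaton l).
Proof. by rewrite ffunE. Qed.

Lemma loc_ord_eq l l' : l \in Fin :: locations Pr -> l' \in Fin :: locations Pr ->
  (loc_ord l == loc_ord l') = (l == l').
Proof. by move=> lP lP'; apply/eqP/eqP => [/loc_ord_inj->|->]. Qed.

Lemma mem_prv : Prv \in Fin :: locations Pr.
Proof. by rewrite inE mem_locations_basic ?orbT. Qed.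

Lemma mem_fin : Fin \in Fin :: locations Pr.
Proof. exact: mem_head. Qed.

(** A run is followed through the current time [t] and the last reset time [r], the clock being
    [t - r]. *)
Lemma path_accepts (p : path_ta R 'I_N.+1 'I_N.+1 'I_1) l (mu : valuation R 'I_1) r t :
  l \in Fin :: locations Pr -> mu ord0 = t - r -> is_path automaton (loc_ord l, mu) p ->
  last (loc_ord l) (locs p) \in final automaton ->
  exists2 w : word, trace_from t p = word_ord w &
    accepts (alphabet Pr) e (has (fun l => l \in priv automaton) (loc_ord l :: locs p)) l r t w.
Proof.
elim: p l mu r t => [|[[d ed] c'] p IH] l mu r t lP mut /=.
  move=> _; rewrite inE loc_ord_eq ?mem_fin // => /eqP->; exists [::] => //.
  by rewrite inE loc_ord_eq ?mem_fin ?mem_prv //; apply: AcceptsFin.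
case=> -[_ [d0 _ ->] [+ + + -> _]] /=; case/mapP => -[[l1 a] [[g rs] l2]] xP -> /=.
have l1P : l1 \in Fin :: locations Pr.
  by move: xP; rewrite mem_raw_edges => /andP[l1P _]; rewrite inE l1P orbT.
move=> /(loc_ord_inj l1P lP) El; subst l1; rewrite sat_edge_of ffunE => sg pp lp.
have l2P := raw_edges_target xP.
have [|w tw aw] := IH l2 _ (if rs then t + d else r) (t + d) l2P _ pp lp.
  by rewrite !ffunE; case: (rs); rewrite inE ?subrr // mut addrAC.
have td : t <= t + d by rewrite lerDl.
have sg' : gsat g (t + d - r) by rewrite addrAC -mut.
move: xP; rewrite mem_raw_edges => /andP[_].
have -> : (loc_ord l \in [set loc_ord Prv]) = (l == Prv) by rewrite inE loc_ord_eq ?mem_prv.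
case: a => [a /andP[aP oP]|oP] /=.
  exists ((a, t + d) :: w); first by rewrite tw.
  exact: AcceptsLetter td aP oP sg' aw.
by exists w => //; apply: AcceptsSilent td oP sg' aw.
Qed.

Lemma accepts_path b l r t w (mu : valuation R 'I_1) :
  accepts (alphabet Pr) e b l r t w -> l \in Fin :: locations Pr -> mu ord0 = t - r ->
  exists p : path_ta R 'I_N.+1 'I_N.+1 'I_1,
    [/\ is_path automaton (loc_ord l, mu) p, last (loc_ord l) (locs p) \in final automaton,
        all (fun l => l \notin final automaton) (belast (loc_ord l) (locs p)),
        has (fun l => l \in priv automaton) (loc_ord l :: locs p) = b &
        trace_from t p = word_ord w].
Proof.
move=> acc; elim: acc mu => {b l r t w} [r t|b l r t t' g rs l' w|b l r t t' a g rs l' w].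
- move=> mu _ _; exists [::]; split=> //=; first by rewrite inE.
  by rewrite inE loc_ord_eq ?mem_fin ?mem_prv.
- move=> tt' oP sg _ IH mu lP mut.
  have lL : l \in locations Pr by move: lP oP; rewrite inE => /predU1P[->|].
  have xP : (l, None, (g, rs, l')) \in raw_edges Pr e by rewrite mem_raw_edges lL.
  have [|p [pp lp ap hp tp]] := IH (reset (delay mu (t' - t)) (if rs then setT else set0))
    (raw_edges_target xP).
    by rewrite !ffunE mut; case: (rs); rewrite inE ?subrr //; lra.
  exists ((t' - t, edge_of (l, None, (g, rs, l')),
    (loc_ord l', reset (delay mu (t' - t)) (if rs then setT else set0))) :: p); split=> //=.
  + split=> //; exists (loc_ord l, delay mu (t' - t)).
      by split=> //; [rewrite subr_ge0 | move=> *; exact: sat_inv].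
    split=> //; [exact: (map_f edge_of xP) | | exact: sat_inv].
    by rewrite sat_edge_of ffunE mut (_ : _ + _ = t' - r) //; lra.
  (* [Fin] has no outgoing arrow, so it is not met before the end. *)
  + rewrite ap andbT inE loc_ord_eq ?mem_fin //.
    by apply: contraTneq oP => ->.
  + by rewrite -hp inE loc_ord_eq ?mem_prv.
  + by rewrite addrC subrK.
- move=> tt' aP oP sg _ IH mu lP mut.
  have lL : l \in locations Pr by move: lP oP; rewrite inE => /predU1P[->|].
  have xP : (l, Some a, (g, rs, l')) \in raw_edges Pr e by rewrite mem_raw_edges lL aP.
  have [|p [pp lp ap hp tp]] := IH (reset (delay mu (t' - t)) (if rs then setT else set0))
    (raw_edges_target xP).
    by rewrite !ffunE mut; case: (rs); rewrite inE ?subrr //; lra.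
  exists ((t' - t, edge_of (l, Some a, (g, rs, l')),
    (loc_ord l', reset (delay mu (t' - t)) (if rs then setT else set0))) :: p); split=> //=.
  + split=> //; exists (loc_ord l, delay mu (t' - t)).
      by split=> //; [rewrite subr_ge0 | move=> *; exact: sat_inv].
    split=> //; [exact: (map_f edge_of xP) | | exact: sat_inv].
    by rewrite sat_edge_of ffunE mut (_ : _ + _ = t' - r) //; lra.
  + rewrite ap andbT inE loc_ord_eq ?mem_fin //.
    by apply: contraTneq oP => ->.
  + by rewrite -hp inE loc_ord_eq ?mem_prv.
  + by rewrite addrC subrK tp.
Qed.

Lemma mem_ini : Ini \in Fin :: locations Pr.
Proof. by rewrite inE mem_locations_basic ?orbT. Qed.

Lemma traces_automaton b (W : seq ('I_N.+1 * R)) :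
  (exists p, [/\ is_run automaton p, is_private automaton p = b & trace p = W]) <->
  (exists2 w, W = word_ord w & accepts (alphabet Pr) e b Ini 0 0 w).
Proof.
split=> [[p [[_ pp lp _] <- <-]]|[w -> aw]].
  have [|w tw aw] := path_accepts (r := 0) (t := 0) mem_ini _ pp lp.
    by rewrite ffunE subrr.
  by exists w.
have [|p [pp lp ap hp tp]] := accepts_path (mu := val0 R 'I_1) aw mem_ini.
  by rewrite ffunE subrr.
by exists p; split=> //; split=> //; apply: sat_inv.
Qed.

Lemma PrivTr_automaton W : PrivTr automaton W <->
  exists2 w, W = word_ord w & accepts (alphabet Pr) e true Ini 0 0 w.
Proof. exact: traces_automaton. Qed.

Lemma PubTr_automaton W : PubTr automaton W <->
  exists2 w, W = word_ord w & accepts (alphabet Pr) e false Ini 0 0 w.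
Proof.
rewrite -traces_automaton.
by split=> -[p [rp pp tp]]; exists p; split=> //; move: pp; case: is_private.
Qed.

Lemma word_ord_inj (w w' : word) : timed (alphabet Pr) 0 w -> timed (alphabet Pr) 0 w' ->
  word_ord w = word_ord w' -> w = w'.
Proof.
move=> /andP[_ aw] /andP[_ aw'].
elim: w w' aw aw' => [[]//|[a x] w IH] [//|[a' x'] w'] /= /andP[aP aw] /andP[aP' aw'].
by case=> /(letter_ord_inj aP aP')-> -> /(IH _ aw aw')->.
Qed.

Lemma weakly_opaque_automaton : weakly_opaque R automaton <-> ~ halting_run Pr e.
Proof.
rewrite -(universal_iff_no_halting_run R); split=> [H w aw|H W].
  have /H/PubTr_automaton[w' E aw'] : PrivTr automaton (word_ord w).
    by apply/PrivTr_automaton; exists w.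
  by rewrite (word_ord_inj (accepts_timed aw) (accepts_timed aw') E).
by move/PrivTr_automaton => [w -> /H aw]; apply/PubTr_automaton; exists w.
Qed.

(** Full and weak opacity agree here: a publicly accepted word is a timed word, and private runs
    accept all of these. *)
Lemma fully_opaque_automaton : fully_opaque R automaton <-> ~ halting_run Pr e.
Proof.
rewrite -weakly_opaque_automaton; split=> [E|sub]; first by rewrite /weakly_opaque E.
apply: funext => W; apply: propext; split; first exact: sub.
move/PubTr_automaton => [w -> aw]; apply/PrivTr_automaton; exists w => //.
exact/accepts_private/(accepts_timed aw).
Qed.

End Automaton.

(** * Coding and self-reference *)

(** The recursion step of [CodeSeq.code]: the code of [a :: s] from [a] and the code of [s]. *)
Definition code_cons a b := 2 ^ a * b.*2.+1.

Lemma code_cons_gt a b : a < code_cons a b /\ b < code_cons a b.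
Proof.
have a2 : a < 2 ^ a by exact: ltn_expl.
by rewrite /code_cons -muln2; split; nia.
Qed.

(** Thanks to this, the code of a list of edges bounds the codes of all locations and letters on
    them, and can serve as [N]. *)
Lemma mem_code_lt n s : n \in s -> n < CodeSeq.code s.
Proof.
elim: s => [//|a s IH]; rewrite inE.
have [h1 h2] := code_cons_gt a (CodeSeq.code s).
by case/orP => [/eqP->//|/IH lt_n]; apply: ltn_trans lt_n h2.
Qed.

Definition code_raw_guard (g : seq (cmp * int)) :=
  CodeSeq.code [seq CodeSeq.code [:: 0; nat_of_cmp c.1; code_int c.2] | c <- g].

Definition code_raw_edge (x : raw_edge) :=
  let: (l, a, (g, rs, l')) := x in
  CodeSeq.code [:: loc_code l; code_raw_guard g; if a is Some b then (letter_code b).+1 else 0;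
                   nat_of_bool rs; loc_code l'].

Definition go_edge e : raw_edge := (Inp, Some (Mk go), ([:: (CLt, Posz e.+1)], false, Err)).
Definition go_loop : raw_edge := (Inp, Some (Mk go), ([::], false, Inp)).
Definition inp_edge e : raw_edge := (Inp, Some (Mk inp), ([:: (CGe, Posz e.+1)], false, Err)).

Definition fixed_edges Pr := drop 3 (raw_edges Pr 0).

(** The constant [e] occurs only in [Inp] on [Mk go] and [Mk inp]. Both letters head the alphabet
    and do not come back, so the edges after the third are the same for all [e]. *)
Lemma raw_edgesE Pr' e (Pr := go :: inp :: Pr') : go \notin Pr' -> inp \notin Pr' ->
  raw_edges Pr e = [:: go_edge e; go_loop; inp_edge e] ++ fixed_edges Pr.
Proof.
move=> ngo ninp; pose G' := behead (behead (alphabet Pr)).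
pose Ls := behead (locations Pr).
have nG a : a \in G' -> (a == Mk go) = false /\ (a == Mk inp) = false.
  rewrite /G' /alphabet /= => aG; split; apply/eqP => Ea; move: aG; rewrite Ea;
    rewrite mem_cat inE mem_map; try (by move=> ? ? []);
    by rewrite ?(negPf ngo) ?(negPf ninp) /= => /flatten_mapP[r _]; rewrite !inE.
have Inp_rest e' : flatten [seq [seq (Inp, Some a, o) | o <- arrows e' Inp a] | a <- G'] =
    [seq (Inp, Some a, ([::], false, Inp)) | a <- G'] :> seq raw_edge.
  elim: (G') nG => [//|a G2 IH] nG; rewrite /= IH; last first.
    by move=> b bG; apply: nG; rewrite inE bG orbT.
  by have [-> ->] := nG a (mem_head _ _).
have rest e' : flatten [seq raw_edges_from Pr e' l | l <- Ls] =
    flatten [seq raw_edges_from Pr 0 l | l <- Ls].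
  congr flatten; apply/eq_in_map => l; rewrite /Ls /= => lL.
  rewrite /raw_edges_from; congr (_ ++ flatten _); apply/eq_map => a.
  case: l lL => //; rewrite !inE /= mem_cat => /orP[] /mapP[] //.
have E e' : raw_edges Pr e' = [:: go_edge e'; go_loop; inp_edge e'] ++
   ((Inp, Some (Mk inp), ([::], false, Inp)) ::
    [seq (Inp, Some a, ([::], false, Inp)) | a <- G'] ++
    flatten [seq raw_edges_from Pr 0 l | l <- Ls]).
  by rewrite -(Inp_rest e') -(rest e').
by rewrite /fixed_edges !E.
Qed.

Definition code_of_fixed Pr := CodeSeq.code [seq code_raw_edge x | x <- fixed_edges Pr].

(* [code_automaton t e] is the code of the automaton whose fixed edges have code
   [t]; it has as many locations and letters as [t] allows, most of them unused. *)
Definition code_automaton t e :=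
  CodeSeq.code [:: t.+1; t.+1; 1; loc_code Ini; CodeSeq.code [:: loc_code Prv];
    CodeSeq.code [:: loc_code Fin]; CodeSeq.code (nseq t.+1 0);
    code_cons (code_raw_edge (go_edge e)) (code_cons (code_raw_edge go_loop)
      (code_cons (code_raw_edge (inp_edge e)) t))].

Section Coding.
Variables (Pr' : seq trans) (e N : nat).
Let Pr := go :: inp :: Pr'.
Hypotheses (ngo : go \notin Pr') (ninp : inp \notin Pr').
Hypothesis NE : N = code_of_fixed Pr.

Lemma fixed_edge_bound l a g rs l' : (l, a, (g, rs, l')) \in fixed_edges Pr ->
  [/\ loc_code l <= N, loc_code l' <= N & forall b, a = Some b -> letter_code b <= N].
Proof.
move=> xP; have := mem_code_lt (map_f code_raw_edge xP); rewrite -[CodeSeq.code _]NE => xN.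
have lt n : n \in [:: loc_code l; code_raw_guard g;
    if a is Some b then (letter_code b).+1 else 0; nat_of_bool rs; loc_code l'] -> n <= N.
  by move=> nP; apply: ltnW; apply: ltn_trans (mem_code_lt nP) xN.
by split; [apply: lt | apply: lt | move=> b E; apply/ltnW/lt]; rewrite ?E !inE eqxx ?orbT.
Qed.

Lemma mem_fixed_edges x : x \in raw_edges Pr 0 -> x != go_edge 0 -> x != go_loop ->
  x != inp_edge 0 -> x \in fixed_edges Pr.
Proof.
rewrite (raw_edgesE 0 ngo ninp) mem_cat => /orP[|//].
by rewrite !inE => /or3P[] /eqP->; rewrite eqxx.
Qed.

(** Every letter labels a loop on [Err], which is a fixed edge. *)
Lemma fixed_letter_bound a : a \in alphabet Pr -> letter_code a <= N.
Proof.
move=> aP; have : (Err, Some a, ([::], false, Err)) \in fixed_edges Pr.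
  apply: mem_fixed_edges; try by apply/eqP.
  by rewrite mem_raw_edges aP.
by case/fixed_edge_bound => _ _; apply.
Qed.

(** Every location is an end of some fixed edge: [Fin] is a target, and each of the others is a
    source. *)
Lemma fixed_loc_bound l : l \in Fin :: locations Pr -> loc_code l <= N.
Proof.
have src l0 a g rs l1 : (l0, a, (g, rs, l1)) \in raw_edges Pr 0 -> l0 != Inp -> loc_code l0 <= N.
  move=> xP nI; have /fixed_edge_bound[] // : (l0, a, (g, rs, l1)) \in fixed_edges Pr.
  by apply: mem_fixed_edges => //; apply: contraNneq nI => -[->].
have goG : Mk go \in alphabet Pr by rewrite mem_alphabet_Mk mem_head.
have startG : Start \in alphabet Pr by rewrite mem_cat mem_head orbT.
have Inp_bound : loc_code Inp <= N.
  have /fixed_edge_bound[] // : (Inp, Some Start, ([::], false, Inp)) \in fixed_edges Pr.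
  apply: mem_fixed_edges; try by apply/eqP.
  by rewrite mem_raw_edges startG.
rewrite inE => /predU1P[->|lP].
  have /fixed_edge_bound[] // : (Err, None, ([::], false, Fin)) \in fixed_edges Pr.
  apply: mem_fixed_edges; try by apply/eqP.
  by rewrite mem_raw_edges.
have [->//|nI] := eqVneq l Inp.
have [a [[[g rs] l1] xP]] : exists a o, (l, a, o) \in raw_edges Pr 0; last exact: src xP nI.
case: l lP nI => [||||||||b|s] lP nI.
- by exists None, ([::], false, Prv); rewrite mem_raw_edges lP.
- by exists None, ([::], false, Fin); rewrite mem_raw_edges lP.
- by move: lP; rewrite !inE /= mem_cat => /orP[] /mapP[].
- by exists (Some Start), ([::], false, Pre); rewrite mem_raw_edges lP startG.
- by exists None, ([::], false, Fin); rewrite mem_raw_edges lP.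
- by [].
- by exists None, ([:: (CGt, 0%R)], true, Gap1); rewrite mem_raw_edges lP.
- exists (Some Start), ([:: (CGt, 0%R); (CLt, 1%R)], false, Gap1).
  by rewrite mem_raw_edges lP startG.
- by exists (Some Start), ([:: (CEq, 0%R)], false, Err); rewrite mem_raw_edges lP startG.
- exists (Some Start), ([::], false, if delta s Start is Some s' then Mon s' else Err).
  by rewrite mem_raw_edges lP startG /= mem_head.
Qed.

Lemma loc_ordK l : l \in Fin :: locations Pr -> nat_of_ord (loc_ord N l) = loc_code l.
Proof. by move=> lP; rewrite inordK // ltnS fixed_loc_bound. Qed.

Lemma code_edge_of x : x \in raw_edges Pr e -> code_edge (edge_of N x) = code_raw_edge x.
Proof.
case: x => [[l a] [[g rs] l']] xP; have l'P := raw_edges_target xP.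
move: xP; rewrite mem_raw_edges => /andP[lP aP].
rewrite /code_edge /code_raw_edge; congr (CodeSeq.code [:: _; _; _; _; _]).
- by apply: loc_ordK; rewrite inE lP orbT.
- by rewrite /code_constraint /code_raw_guard -map_comp.
- case: a aP => [b /andP[bP _]|//] /=.
  by rewrite inordK // ltnS fixed_letter_bound.
- rewrite /code_set /=; case: rs {aP l'P}; last by rewrite enum_set0.
  by rewrite enum_setT -enumT val_enum_ord.
- exact: loc_ordK.
Qed.

Lemma code_ta_automaton : code_ta (automaton N Pr e) = code_automaton N e.
Proof.
rewrite /code_ta /code_automaton; congr (CodeSeq.code [:: _; _; _; _; _; _; _; _]).
- exact/loc_ordK/mem_ini.
- by rewrite /code_set enum_set1; congr (CodeSeq.code [:: _]); exact/loc_ordK/mem_prv.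
- by rewrite /code_set enum_set1; congr (CodeSeq.code [:: _]); exact/loc_ordK/mem_fin.
- congr CodeSeq.code; rewrite -[in RHS](size_enum_ord N.+1).
  by elim: (enum _) => //= i s ->; rewrite ffunE.
- have -> : [seq code_edge x | x <- edges (automaton N Pr e)] =
    [seq code_raw_edge x | x <- raw_edges Pr e].
    by rewrite -map_comp; apply/eq_in_map => x; apply: code_edge_of.
  by rewrite raw_edgesE // map_cat NE.
Qed.

End Coding.

(** * Recursiveness of the coding, and the diagonal argument *)

Definition recursive (F : nat -> nat) := exists f : recfun 1,
  forall x, computes f [tuple x] (F x).

Lemma computes_comp1 k (f : recfun 1) (g : recfun k) v x y :
  computes g v x -> computes f [tuple x] y -> computes (RComp f (fun _ : 'I_1 => g)) v y.
Proof. by move=> gx fy; exists [tuple x] => // i; rewrite ord1. Qed.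

Lemma recursive_comp F G : recursive F -> recursive G -> recursive (fun x => F (G x)).
Proof.
move=> [f fF] [g gG]; exists (RComp f (fun=> g)) => x.
by apply: computes_comp1 (gG x) (fF _).
Qed.

Lemma recursive_id : recursive id.
Proof. by exists (RProj ord0). Qed.

Lemma recursive_succ : recursive succn.
Proof. by exists RSucc. Qed.

Lemma recursive_const c : recursive (fun=> c).
Proof.
elim: c => [|c IH]; first by exists (RZero 1).
exact: recursive_comp recursive_succ IH.
Qed.

Lemma recursive_iter G a : recursive G -> recursive (fun n => iter n G a).
Proof.
move=> [g gG]; have [f0 fa] : exists f : recfun 0, computes f [tuple] a.
  elim: a => [|a [f IH]]; first by exists (RZero 0).
  by exists (RComp RSucc (fun=> f)); apply: computes_comp1 IH _.
(* The step function receives the index and then the previous value, which [inord 1] selects. *)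
exists (RPrim f0 (RComp g (fun=> RProj (inord 1)))) => n /=.
exists (fun i => iter i G a); split=> //.
  by rewrite (_ : (behead_tuple [tuple n] : 0.-tuple nat) = [tuple]) // tuple0.
move=> i _; apply: (@computes_comp1 _ g (RProj (inord 1)) _ (iter i G a)) => //.
by rewrite /= (tnth_nth 0) /= inordK.
Qed.

Lemma recursive_double : recursive double.
Proof.
have [f fP] := recursive_iter 0 (recursive_comp recursive_succ recursive_succ).
by exists f.
Qed.

(** [code_cons a b] is [b.*2.+1] doubled [a] times, a primitive recursion on [a]. *)
Lemma recursive_code_cons F G : recursive F -> recursive G ->
  recursive (fun x => code_cons (F x) (G x)).
Proof.
move=> [f fF] [g gG]; have [d dP] := recursive_double.
have [d1 d1P] := recursive_comp recursive_succ recursive_double.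
pose c : recfun 2 := RPrim d1 (RComp d (fun=> RProj (inord 1))).
have cP a b : computes c [tuple a; b] (code_cons a b).
  exists (fun i => code_cons i b); split=> //.
    rewrite /code_cons mul1n (_ : (behead_tuple [tuple a; b] : 1.-tuple nat) = [tuple b]) //.
    exact: val_inj.
  move=> i _; apply: (@computes_comp1 _ d (RProj (inord 1)) _ (code_cons i b)).
    by rewrite /= (tnth_nth 0) /= inordK.
  have -> : code_cons i.+1 b = (code_cons i b).*2; last exact: dP.
  by rewrite /code_cons expnS -!mul2n mulnA.
exists (RComp c (fun i : 'I_2 => if i == ord0 then f else g)) => x.
exists [tuple F x; G x] => // i; rewrite (tnth_nth 0).
by case: i => -[|[|//]] ? /=.
Qed.

(** Putting a zero in front of a list turns its code [m] into [m.*2.+1]. *)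
Lemma recursive_code_nseq : recursive (fun n => CodeSeq.code (nseq n 0)).
Proof.
have [f fP] := recursive_iter 0 (recursive_comp recursive_succ recursive_double).
exists f => x; have := fP x; congr computes.
by elim: x => //= x ->; rewrite mul1n.
Qed.

Lemma recursive_code_raw_edge l a b l' :
  recursive (fun t => code_raw_edge (l, a, ([:: (b, Posz t.+1)], false, l'))).
Proof.
have cst := recursive_const; have cons := recursive_code_cons.
have int : recursive (fun t => t.+1.*2) := recursive_comp recursive_double recursive_succ.
have guard := cons _ _
  (cons _ _ (cst 0) (cons _ _ (cst (nat_of_cmp b)) (cons _ _ int (cst 0)))) (cst 0).
exact: (cons _ _ (cst (loc_code l)) (cons _ _ guard (cons _ _
  (cst (if a is Some b then (letter_code b).+1 else 0))
  (cons _ _ (cst 0) (cons _ _ (cst (loc_code l')) (cst 0)))))).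
Qed.

Lemma recursive_code_automaton : recursive (fun t => code_automaton t t).
Proof.
have cst := recursive_const; have cons := recursive_code_cons.
have succ := recursive_succ.
have invs := recursive_comp recursive_code_nseq succ.
have edges := cons _ _ (recursive_code_raw_edge Inp (Some (Mk go)) CLt Err)
  (cons _ _ (cst (code_raw_edge go_loop))
  (cons _ _ (recursive_code_raw_edge Inp (Some (Mk inp)) CGe Err) recursive_id)).
exact: (cons _ _ succ (cons _ _ succ (cons _ _ (cst 1) (cons _ _ (cst (loc_code Ini))
  (cons _ _ (cst (CodeSeq.code [:: loc_code Prv]))
  (cons _ _ (cst (CodeSeq.code [:: loc_code Fin]))
  (cons _ _ invs (cons _ _ edges (cst 0))))))))).
Qed.

(** The same number [T] is the bound on indices, the constant in the guards and the input of the
    machine. Hence [code_automaton T T], on which the machine of [h] runs the decider, is the code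
    of the automaton built from this very machine. *)
Lemma undecidable_of_halting (P : forall n m, ta 'I_n 'I_m 'I_1 -> Prop) :
  (forall N Pr e, (forall l, l \in Fin :: locations Pr -> loc_code l <= N) ->
     (forall a, a \in alphabet Pr -> letter_code a <= N) ->
     P _ _ (automaton N Pr e) <-> ~ halting_run Pr e) ->
  ~ ta_decidable P.
Proof.
move=> PP [f fP]; have [s sP] := recursive_code_automaton.
pose h : recfun 1 := RComp f (fun=> s).
pose p := compile h (fun=> 0) 1 2.
pose Pr' := behead (behead (machine p)).
have MP : machine p = go :: inp :: Pr' by [].
have src t : t \in Pr' -> 1 < t.1.1.
  by rewrite !inE => /or3P[/eqP->|/eqP->|/flat_src/andP[]].
have ngo : go \notin Pr' by apply/negP => /src.
have ninp : inp \notin Pr' by apply/negP => /src.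
(* The existential hides the body of [T], a number too large to be computed. *)
have [T TE] : exists T, T = code_of_fixed (go :: inp :: Pr') by eexists.
rewrite -MP in TE.
have PT := PP T (machine p) T (fixed_loc_bound ngo ninp TE) (fixed_letter_bound ngo ninp TE).
have [f1 f0] := fP _ _ (automaton T (machine p) T).
have hT y : computes f [tuple code_ta (automaton T (machine p) T)] y -> computes h [tuple T] y.
  by rewrite (code_ta_automaton T ngo ninp TE); apply: computes_comp1 (sP T).
have haltE y : computes h [tuple T] y -> halting_run (machine p) T <-> 0 < y.
  exact: halts_compile.
(* If [P] holds then [h] yields 1 and the machine halts; otherwise [h] yields 0 and it does not.
   Both cases contradict [PT]. *)
have [A|nA] := pselect (P _ _ (automaton T (machine p) T)).
  by apply: (PT.1 A); apply/(haltE _ (hT _ (f1 A))).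
by apply: (nA); apply/PT => /(haltE _ (hT _ (f0 nA))).
Qed.

Theorem theorem5p4 (R : realType) :
  ~ ta_decidable (fun n m (A : ta 'I_n 'I_m 'I_1) => fully_opaque R A) /\
  ~ ta_decidable (fun n m (A : ta 'I_n 'I_m 'I_1) => weakly_opaque R A).
Proof.
split; apply: undecidable_of_halting => N Pr e locN letN.
  exact: fully_opaque_automaton.
exact: weakly_opaque_automaton.
Qed.
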